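(* Let $u_k:\mathbb{R}\to\mathbb{R}$, $k\in\mathbb{N}$, be continuous functions satisfying $$\limsup_{k\uparrow\infty}\int_{\mathbb{R}}\left|\tfrac{d}{ds}u_k(s)\right|^2ds<\infty$$ and $$\limsup_{s\downarrow-\infty}u_k(s)<0\quad\text{and}\quad\liminf_{s\uparrow\infty}u_k(s)>0\qquad\text{for every }k\in\mathbb{N},$$ where $\frac{d}{ds}u_k$ denotes the distributional derivative of $u_k$. Then for each $k\in\mathbb{N}$ there exists a zero $z_k$ of $u_k$, and there exists a limit $u\in\dot H^1(\mathbb{R})$ with $u(0)=0$, such that, for a subsequence, $$u_k(\cdot+z_k)\to u\quad\text{locally uniformly in }\mathbb{R}\text{ and weakly in }\dot H^1(\mathbb{R}),$$ and $$\limsup_{s\downarrow-\infty}u(s)\le0\quad\text{as well as}\quad\liminf_{s\uparrow\infty}u(s)\ge0.$$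
   Context: $\dot H^1(\mathbb{R})$ denotes the (continuous) functions on $\mathbb{R}$ whose distributional derivative lies in $L^2(\mathbb{R})$; weak convergence in $\dot H^1(\mathbb{R})$ means weak convergence of the derivatives in $L^2(\mathbb{R})$. *)

(* Defs.v *)
From HB Require Import structures.
From mathcomp Require Export all_boot all_order all_algebra.
From mathcomp Require Export all_classical all_reals all_analysis.

Set Implicit Arguments.
Unset Strict Implicit.
Unset Printing Implicit Defensive.

Import Order.TTheory GRing.Theory Num.Theory.
Import numFieldNormedType.Exports.

Local Open Scope ring_scope.
Local Open Scope classical_set_scope.

Section Defs.
Context {R : realType}.
Implicit Types (u g h phi : R -> R).

Definition L2 : set (R -> R) := [set g | g \in Lfun (@lebesgue_measure R) 2%:E].

Definition test_function phi : Prop :=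
  (forall (n : nat) (x : R), derivable (derive1n n phi) x 1) /\
  compact (closure [set x | phi x != 0]).

Definition is_distr_deriv u g : Prop :=
  locally_integrable setT g /\
  forall phi, test_function phi ->
    \int[@lebesgue_measure R]_s (u s * derive1 phi s) =
    - \int[@lebesgue_measure R]_s (g s * phi s).

(* A representative, unique up to Lebesgue-null sets; it is meaningful only
   when the distributional derivative of u is a locally integrable function. *)
Definition distr_deriv u : R -> R :=
  xget (cst 0) [set g | is_distr_deriv u g].

(* The integral of |du/ds|^2, with the usual convention that it is infinite
   when the distributional derivative of u is not a function. *)
Definition dirichlet u : \bar R :=
  if `[< exists g, is_distr_deriv u g >]
  then (\int[@lebesgue_measure R]_s (`|distr_deriv u s| ^+ 2)%:E)%E
  else +oo%E.

Definition H1dot : set (R -> R) :=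
  [set u | [/\ continuous u, exists g, is_distr_deriv u g & L2 (distr_deriv u)]].

Definition weak_cvg_L2 (f : nat -> R -> R) (g : R -> R) : Prop :=
  [/\ forall k, L2 (f k), L2 g &
   forall h, L2 h ->
     \int[@lebesgue_measure R]_s (f k s * h s) @[k --> \oo] -->
     \int[@lebesgue_measure R]_s (g s * h s)].

Definition weak_cvg_H1dot (v : nat -> R -> R) (w : R -> R) : Prop :=
  [/\ forall k, H1dot (v k), H1dot w &
   weak_cvg_L2 (fun k => distr_deriv (v k)) (distr_deriv w)].

Definition locally_uniform_cvg (v : nat -> R -> R) (w : R -> R) : Prop :=
  forall x : R, exists2 U : set R, nbhs x U & {uniform U, v @ \oo --> w}.

Definition limsup_ninfty u : \bar R := limf_esup (EFin \o u) (ninfty_nbhs R).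
Definition liminf_pinfty u : \bar R := limf_einf (EFin \o u) (pinfty_nbhs R).

End Defs.

(* Main.v *)
Require Import Defs.
From mathcomp Require Import measurable_realfun lra ring.

(** The zeros are chosen by a variational principle. Since u_k is negative near
    -oo and positive near +oo, its primitive U_k attains a global minimum; z_k
    is a point where it does, so u_k(z_k) = 0 ([zero_at_minimum]). The
    recentred functions v_k = u_k(. + z_k) vanish at 0 and have bounded
    Dirichlet energy, so they are equi-Hoelder of exponent 1/2, and a
    subsequence converges locally uniformly to some w ([hoelder_compactness]).
    The energy bound passes to w, which therefore has a square-integrable
    derivative, and the derivatives converge weakly ([energy_H1dot],
    [energy_weak_cvg]). Moreover 0 is a global minimum of the primitive W of w
    ([minimum_limit]).

    If w satisfies both sign conditions at infinity, it is the limit sought.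
    Suppose that the condition at +oo fails, so that w <= - d < 0 at points
    arbitrarily far to the right. Were w eventually nonpositive, each of these
    points would contribute a fixed amount to the decrease of W, by the Hoelder
    bound, and W would tend to -oo although it is bounded below by W(0). Hence
    w changes sign arbitrarily far to the right ([sign_changes_pinfty]; the
    failure at -oo is symmetric). Near a sign change of w the functions v_k with
    k large have zeros, and far out w carries arbitrarily little energy, so it
    is almost constant at any fixed scale. Recentring at such zeros, along a
    diagonal subsequence, makes the limit identically 0 ([vanishing_limit]),
    which satisfies all the requirements.

    The analysis behind this rests on two facts. A continuous function whose
    distributional derivative g is locally integrable has increments given by
    the integrals of g ([distr_deriv_FTC]); this follows by testing with smooth
    approximations of indicators of intervals, and for the zero function it is
    the du Bois-Reymond lemma. And a functional on test functions that is
    bounded for the L^2 norm is represented by an L^2 limit of test functions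
    ([riesz_test]). The energy bound is expressed by duality with test functions
    ([energy_le]): it is then visibly stable under translations and locally
    uniform limits, and the representation recovers the derivative from it. *)

Set Implicit Arguments.
Unset Strict Implicit.
Unset Printing Implicit Defensive.

Import Order.TTheory GRing.Theory Num.Theory.
Import numFieldNormedType.Exports.

Local Open Scope ring_scope.
Local Open Scope classical_set_scope.

(** * Primitives of continuous functions *)

Section Calculus.
Context {R : realType}.
Implicit Types (f g u : R -> R) (x a b c : R).
Notation mu := (@lebesgue_measure R).

Lemma is_derive_continuous f (f' : R -> R) :
  (forall x, is_derive x 1 f (f' x)) -> continuous f.
Proof.
move=> df x; apply: differentiable_continuous; apply/derivable1_diffP.
by case: (df x).
Qed.

Lemma mean_value f (f' : R -> R) a b :
  (forall x, is_derive x 1 f (f' x)) -> a <= b ->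
  exists c, [/\ a <= c, c <= b & f b - f a = f' c * (b - a)].
Proof.
move=> df ab.
have [|c] := MVT_segment ab (fun x _ => df x).
- exact/continuous_subspaceT/(is_derive_continuous df).
- by rewrite in_itv/= => /andP[? ?] ?; exists c.
Qed.

Lemma continuous_integrable f a b :
  continuous f -> mu.-integrable `[a, b] (EFin \o f).
Proof.
move=> cf; apply: continuous_compact_integrable; first exact: segment_compact.
exact: continuous_subspaceT.
Qed.

Lemma antiderivative f : continuous f ->
  exists F : R -> R, forall x, is_derive x 1 F (f x).
Proof.
move=> cf.
have fi a b : mu.-integrable `[a, b] (EFin \o f) by exact: continuous_integrable.
pose P a y := \int[mu]_(t in `[a, y]) f t.
(* Primitives based at different points differ by constants; normalised to
   vanish at 0 they agree wherever both are defined, and can be glued. *)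
have PB a b y : a <= b -> b <= y -> P a y - P a b = P b y.
  move=> ab aby; rewrite /P.
  rewrite Rintegral_itvB//= ?bnd_simp// Rintegral_itv_obnd_cbnd//.
  by apply: integrableS (fi b y) => //; apply: subset_itvr; rewrite bnd_simp.
pose F y := P (- `|y| - 1) y - P (- `|y| - 1) 0.
have FE M y : `|y| < M -> F y = P (- M) y - P (- M) 0.
  move=> yM; rewrite /F.
  have /andP[y0 y1] : - `|y| <= y <= `|y| by rewrite -ler_norml.
  have n0 := normr_ge0 y.
  have [h|h] := leP (- `|y| - 1) (- M).
    by have := PB (- `|y| - 1) (- M) y; have := PB (- `|y| - 1) (- M) 0; lra.
  by have := PB (- M) (- `|y| - 1) y; have := PB (- M) (- `|y| - 1) 0; lra.
exists F => x; pose M : R := `|x| + 1.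
have /andP[y0 y1] : - `|x| <= x <= `|x| by rewrite -ler_norml.
have xM : x < x + 1 by lra.
have Mx : - M < x by rewrite /M; lra.
have [dP eP] := continuous_FTC1_closed xM (fi (- M) _) Mx (cf x).
have := DeriveDef dP erefl; rewrite -derive1E eP => {}dP.
apply: (@near_eq_is_derive _ _ _ (fun y => P (- M) y - P (- M) 0)).
  near=> y; apply/esym/FE; rewrite /M.
  have -> : y = x - (x - y) by ring.
  apply: le_lt_trans (ler_normB _ _) _; rewrite ltrD2l.
  by near: y; apply: (@cvgr_dist_lt _ _ _ _ _ id) => //.
apply: (is_derive_eq (is_deriveB dP (is_derive_cst _ _ _))).
by rewrite subr0.
Unshelve. all: by end_near. Qed.

End Calculus.

(** * Smooth functions and a smooth step *)

Section Smooth.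
Context {R : realType}.
Implicit Types (f g : R -> R) (x a b c : R).

(** Differentiating first and recursing on the derivative, instead of
    differentiating the n-th derivative, lets sums, products and affine changes
    of variable be treated by induction on n with f generalised. *)
Fixpoint differentiable_upto (n : nat) f : Prop :=
  if n is m.+1 then
    (forall x, derivable f x 1) /\ differentiable_upto m (derive1 f)
  else True.

Definition smooth f := forall n, differentiable_upto n f.

Lemma smoothP f : smooth f <-> forall n x, derivable (derive1n n f) x 1.
Proof.
split=> [sf n|sf n].
  have : differentiable_upto n.+1 f by exact: sf.
  elim: n f {sf} => [f []//|n IH f [df /IH h] x].
  by rewrite derive1Sn; exact: h.
elim: n f sf => // n IH f sf; split; first exact: (sf 0%N).
by apply: IH => m x; have := sf m.+1 x; rewrite derive1Sn.
Qed.

Lemma is_derive1_derive1 f (f' : R -> R) :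
  (forall x, is_derive x 1 f (f' x)) -> derive1 f = f'.
Proof. by move=> df; apply/funext => x; rewrite derive1E; case: (df x). Qed.

Lemma derivable_is_derive1 f : (forall x, derivable f x 1) ->
  forall x, is_derive x 1 f (derive1 f x).
Proof. by move=> df x; rewrite derive1E; exact: DeriveDef. Qed.

Lemma differentiable_upto_is_derive n f (f' : R -> R) :
  (forall x, is_derive x 1 f (f' x)) -> differentiable_upto n f' ->
  differentiable_upto n.+1 f.
Proof.
move=> df nf'; split; first by move=> x; case: (df x).
by rewrite (is_derive1_derive1 df).
Qed.

Lemma smooth_is_derive f (f' : R -> R) :
  (forall x, is_derive x 1 f (f' x)) -> smooth f' -> smooth f.
Proof. by move=> df sf' [//|n]; exact: differentiable_upto_is_derive df _. Qed.

Lemma smooth_is_derive1 f : smooth f -> forall x, is_derive x 1 f (derive1 f x).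
Proof. by move=> sf; apply: derivable_is_derive1; case: (sf 1%N). Qed.

Lemma smooth_derive1 f : smooth f -> smooth (derive1 f).
Proof. by move=> sf n; case: (sf n.+1). Qed.

Lemma smooth_continuous f : smooth f -> continuous f.
Proof. by move=> /smooth_is_derive1; exact: is_derive_continuous. Qed.

Lemma is_derive_lin f g a b x (f' g' : R) : is_derive x 1 f f' ->
  is_derive x 1 g g' ->
  is_derive x 1 (fun y => a * f y + b * g y) (a * f' + b * g').
Proof.
move=> df dg.
exact: (is_deriveD (is_deriveZ a df) (is_deriveZ b dg)).
Qed.

Lemma differentiable_upto_lin n f g a b :
  differentiable_upto n f -> differentiable_upto n g ->
  differentiable_upto n (fun x => a * f x + b * g x).
Proof.
elim: n f g => // n IH f g [/derivable_is_derive1 df nf] [/derivable_is_derive1 dg ng].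
have dfg x := is_derive_lin a b (df x) (dg x).
apply: (differentiable_upto_is_derive dfg).
exact: IH.
Qed.

Lemma smooth_lin f g a b : smooth f -> smooth g ->
  smooth (fun x => a * f x + b * g x).
Proof. by move=> sf sg n; exact: differentiable_upto_lin. Qed.

Lemma differentiable_upto_pred n f :
  differentiable_upto n.+1 f -> differentiable_upto n f.
Proof. by elim: n f => // n IH f [df h]; split=> //; exact: IH. Qed.

Lemma smoothM f g : smooth f -> smooth g -> smooth (f \* g).
Proof.
move=> sf sg n; move: (sf n) (sg n) => {sf sg}.
elim: n f g => // n IH f g nf ng.
have [/derivable_is_derive1 df nf'] := nf.
have [/derivable_is_derive1 dg ng'] := ng.
have dfg x : is_derive x 1 (f \* g) (1 * (f \* g^`()) x + 1 * (g \* f^`()) x).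
  rewrite !mul1r; exact: (is_deriveM (df x) (dg x)).
apply: (differentiable_upto_is_derive dfg).
by apply: differentiable_upto_lin; apply: IH => //; exact: differentiable_upto_pred.
Qed.

Lemma is_derive_affine f a b x (f' : R) : is_derive (a * x + b) 1 f f' ->
  is_derive x 1 (fun y => f (a * y + b)) (a * f').
Proof.
move=> df; rewrite mulrC.
have dl : is_derive x 1 (fun y => a * y + b) a.
  apply: (is_derive_eq (is_deriveD (is_deriveZ a (is_derive_id x 1)) (is_derive_cst b x 1))).
  by rewrite addr0 /GRing.scale/= mulr1.
exact: (@is_derive1_comp _ f (fun y => a * y + b) x _ _ df dl).
Qed.

Lemma is_derive_translate f c x (f' : R) : is_derive (x + c) 1 f f' ->
  is_derive x 1 (fun y => f (y + c)) f'.
Proof.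
move=> df; have := @is_derive_affine f 1 c x f'; rewrite !mul1r => /(_ df).
by under eq_fun do rewrite mul1r.
Qed.

Lemma continuous_translate f c : continuous f -> continuous (fun x => f (x + c)).
Proof.
move=> cf x; apply: (@continuous_comp _ _ _ (fun x => x + c) f); last exact: cf.
by apply: cvgD; [exact: cvg_id|exact: cvg_cst].
Qed.

Lemma smooth_affine f a b : smooth f -> smooth (fun x => f (a * x + b)).
Proof.
move=> sf n; elim: n f {sf}(sf n) => // n IH f [/derivable_is_derive1 df nf].
have dfab x : is_derive x 1 (fun x => f (a * x + b))
    (a * derive1 f (a * x + b) + 0 * derive1 f (a * x + b)).
  by rewrite mul0r addr0; exact: is_derive_affine.
apply: (differentiable_upto_is_derive dfab).
by apply: differentiable_upto_lin; exact: IH.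
Qed.

Lemma smooth_cst c : smooth (cst c).
Proof.
move=> n; elim: n c => // n IH c.
exact: (@differentiable_upto_is_derive _ _ (cst 0)).
Qed.

(** The flat functions x^-n exp(-1/x), extended by zero to x <= 0: their span
    is stable under differentiation, which makes each of them smooth. *)
Definition flat (n : nat) x : R := if 0 < x then x ^- n * expR (- x^-1) else 0.

(** The exponential of 1/x dominates its Taylor term of order n + 2. *)
Lemma flat_bound n x : 0 < x -> flat n.+1 x <= (n.+2)`!%:R * x.
Proof.
move=> x0; rewrite /flat x0 expRN.
have i0 : 0 <= x^-1 by rewrite invr_ge0 ltW.
have := expR_ge1Dxn n.+1 i0; set e := expR _ => he.
have e0 : 0 < e by exact: expR_gt0.
have f0 : (0 : R) < (n.+2)`!%:R by rewrite ltr0n fact_gt0.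
rewrite ler_pdivrMr//.
apply: le_trans (_ : _ <= (n.+2)`!%:R * x * (x^-1 ^+ n.+2 / n.+2`!%:R)) _.
  rewrite le_eqVlt; apply/orP; left; apply/eqP.
  rewrite exprVn [x ^+ n.+2]exprS; move: f0 (x ^+ n.+1) (exprn_gt0 n.+1 x0) => /=.
  move: (n.+2)`!%:R => d d0 y y0; field.
  by rewrite !gt_eqF.
rewrite ler_wpM2l//; first by rewrite mulr_ge0// ltW.
by apply: le_trans he; rewrite lerDr.
Qed.

Lemma is_derive_flat n x :
  is_derive x 1 (flat n) (- n%:R * flat n.+1 x + 1 * flat n.+2 x).
Proof.
have [x0|x0|->] := ltrgtP x 0.
- have E m : flat m x = 0 by rewrite /flat ltNge ltW.
  rewrite !E !mulr0 addr0.
  apply: (@near_eq_is_derive _ _ _ (cst 0)) => /=.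
  near=> y; rewrite /flat ltNge ltW//.
  by near: y; exact: lt_nbhsl.
- have E m : flat m x = x ^- m * expR (- x^-1) by rewrite /flat x0.
  rewrite !E.

  have x1 : id x != 0 by rewrite gt_eqF.
  have dV := is_deriveV x1 (is_derive_id x 1).
  have := is_deriveX n dV; rewrite exprfctE => dX.
  have dE := @is_derive1_comp _ expR (fun y => - y^-1) x _ _
    (is_derive_expR _) (is_deriveN dV).
  have := is_deriveM dX dE.
  set g := (X in is_derive _ _ X _) => dg.
  apply: (@near_eq_is_derive _ _ _ g).
    near=> y; rewrite /g /flat/=; suff -> : 0 < y by rewrite -exprVn.
    by near: y; exact: lt_nbhsr.
  apply: (is_derive_eq dg).
  (* The rule for powers involves n - 1, hence the case n = 0. *)
  rewrite /GRing.scale/= !mulr1 expr2.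
  case: n {g dg dX dE E} => [|n].
    by rewrite !expr0 expr1 expr2; field; rewrite gt_eqF.
  rewrite [n.+1.-1]/= !exprVn !exprS.
  have := exprn_gt0 n x0; move: (x ^+ n) (n.+1%:R : R) => y m y0; field.
  by rewrite !gt_eqF.
have F0 m : flat m 0 = 0 by rewrite /flat ltxx.
rewrite !F0 !mulr0 addr0.
suff h : h^-1 *: ((flat n \o shift 0) (h *: (1 : R)) - flat n 0) @[h --> 0^'] --> (0 : R).
  by apply: DeriveDef; [apply/cvg_ex; exists 0 | exact/cvg_lim].
rewrite F0; apply/cvgrPdist_le => e e0.
near=> h; rewrite /= subr0 addr0 /GRing.scale/= mulr1 sub0r normrN.
have [h0|h0] := leP h 0; first by rewrite /flat ltNge h0/= mulr0 normr0 ltW.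
have -> : h^-1 * flat n h = flat n.+1 h.
  by rewrite /flat h0 mulrA exprS invfM.
rewrite ger0_norm; last by rewrite /flat h0 mulr_ge0 ?expR_ge0 ?invr_ge0 ?exprn_ge0 ?ltW.
apply: le_trans (flat_bound _ h0) _.
rewrite mulrC -ler_pdivlMr ?ltr0n ?fact_gt0//.
apply: le_trans (ler_norm h) _; near: h; apply: dnbhs0_le => //.
by rewrite divr_gt0 ?ltr0n ?fact_gt0.
Unshelve. all: by end_near. Qed.

Lemma smooth_flat n : smooth (flat n).
Proof.
move=> m; elim: m n => // m IH n.
apply: (differentiable_upto_is_derive (is_derive_flat n)).
exact: differentiable_upto_lin.
Qed.

(** The normalised primitive of a bump supported in the unit interval. *)
Lemma smooth_step : exists H : R -> R, [/\ smooth H,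
  forall x, 0 <= derive1 H x,
  forall x, (x <= 0) || (1 <= x) -> derive1 H x = 0,
  forall x, x <= 0 -> H x = 0 &
  forall x, 1 <= x -> H x = 1].
Proof.
pose eta : R -> R := flat 0 \* (fun x => flat 0 (- 1 * x + 1)).
have seta : smooth eta.
  by apply: smoothM; [|apply: smooth_affine]; exact: smooth_flat.
have fge0 x : 0 <= flat 0 x.
  by rewrite /flat; case: ifP => // x0; rewrite expr0 invr1 mul1r expR_ge0.
have eta0 x : 0 <= eta x by rewrite mulr_ge0.
have etaout x : (x <= 0) || (1 <= x) -> eta x = 0.
  case/orP => x0; rewrite /eta/= /flat; first by rewrite ltNge x0 mul0r.
  by rewrite (_ : 0 < -1 * x + 1 = false) ?mulr0//; lra.
have [U dU] := antiderivative (smooth_continuous seta).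
have c0 : 0 < U 1 - U 0.
  have [] // := @MVT R U eta 0 1 ltr01 (fun x _ => dU x).
    exact/continuous_subspaceT/(is_derive_continuous dU).
  move=> c; rewrite in_itv/= => /andP[c0 c1] ->.
  rewrite subr0 mulr1 /eta/= /flat c0.
  have -> : 0 < -1 * c + 1 by lra.
  by rewrite !expr0 invr1 !mul1r mulr_gt0 ?expR_gt0.
set c := U 1 - U 0 in c0.
exists (fun x => c^-1 * U x + (- c^-1) * cst (U 0) x).
have dH x : is_derive x 1 (fun x => c^-1 * U x + (- c^-1) * cst (U 0) x) (c^-1 * eta x).
  apply: (is_derive_eq (is_derive_lin _ _ (dU x) (is_derive_cst _ _ _))).
  by rewrite mulr0 addr0.
split.
- apply: smooth_is_derive dH _.
  have := smooth_lin (c^-1) 0 seta seta.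
  by congr smooth; apply/funext => x; rewrite mul0r addr0.
- by move=> x; rewrite (is_derive1_derive1 dH) mulr_ge0// invr_ge0 ltW.
- move=> x xP; rewrite (is_derive1_derive1 dH); apply/eqP.
  by rewrite mulf_eq0 etaout ?eqxx ?orbT.
- move=> x x0 /=.
  have [t [_ t0]] := mean_value dU x0.
  rewrite etaout ?t0// mul0r => /eqP; rewrite subr_eq0 => /eqP ->.
  by rewrite mulNr subrr.
- move=> x x1 /=.
  have [t [t0 _]] := mean_value dU x1.
  rewrite etaout ?t0 ?orbT// mul0r => /eqP; rewrite subr_eq0 => /eqP ->.
  by rewrite mulNr -mulrBr mulVf// gt_eqF.
Qed.

End Smooth.

(** * Integrals of real functions over the line *)

Section RealIntegral.
Context {R : realType}.
Implicit Types (f g : R -> R) (a b : R).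
Notation mu := (@lebesgue_measure R).

Definition integrableR f := mu.-integrable setT (EFin \o f).

(** Measurability of the domain is taken in the sigma-algebra that carries the
    Lebesgue measure. *)
Definition measurableR f := measurable_fun (setT : set (measurableTypeR R)) f.

Lemma measurableR_continuous f : continuous f -> measurableR f.
Proof. by move=> cf; exact: continuous_measurable_fun. Qed.

Lemma integrableR_lin a b f g : integrableR f -> integrableR g ->
  integrableR (fun s => a * f s + b * g s).
Proof.
move=> fi gi.
have := integrableD measurableT (integrableZl measurableT a fi)
  (integrableZl measurableT b gi).
exact: eq_integrable.
Qed.



Lemma Rintegral_lin a b f g : integrableR f -> integrableR g ->
  \int[mu]_s (a * f s + b * g s) = a * \int[mu]_s f s + b * \int[mu]_s g s.
Proof.
move=> fi gi.
have afi : integrableR (fun s => a * f s).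
  have := integrableZl measurableT a fi; exact: eq_integrable.
have bgi : integrableR (fun s => b * g s).
  have := integrableZl measurableT b gi; exact: eq_integrable.
by rewrite (RintegralD measurableT afi bgi) !RintegralZl.
Qed.

Lemma le_integrableR f g : measurableR f -> integrableR g ->
  (forall s, `|f s| <= g s) -> integrableR f.
Proof.
move=> mf gi fg; apply: le_integrable gi => //; first exact/measurable_EFinP.
by move=> s _ /=; rewrite lee_fin (le_trans (fg s))// ler_norm.
Qed.

Lemma restrict_id (A : set R) f : (forall s, ~ A s -> f s = 0) -> f \_ A = f.
Proof.
move=> f0; apply/funext => s; rewrite patchE; case: ifPn => // /negP sA.
by rewrite f0// => As; apply: sA; rewrite inE.
Qed.

Lemma Rintegral_restrict (A : set R) f : (forall s, ~ A s -> f s = 0) ->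
  \int[mu]_(s in A) f s = \int[mu]_s f s.
Proof. by move=> f0; rewrite Rintegral_mkcond (restrict_id f0). Qed.

Lemma integrableR_restrict (A : set (measurableTypeR R)) f : measurable A ->
  (forall s, ~ A s -> f s = 0) -> mu.-integrable A (EFin \o f) -> integrableR f.
Proof.
move=> mA f0 fi; have := (@integrable_mkcond _ _ _ mu A (EFin \o f) mA).1 fi.
apply: eq_integrable => // s _; rewrite patchE/=; case: ifPn => // /negP sA.
by rewrite f0// => As; apply: sA; rewrite inE.
Qed.

Lemma integrableR_continuous f a b : continuous f ->
  (forall s, ~ `[a, b]%classic s -> f s = 0) -> integrableR f.
Proof.
move=> cf f0; apply: integrableR_restrict f0 _ => //.
exact: continuous_integrable.
Qed.

Lemma Rintegral_dominated (fn : nat -> R -> R) f g :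
  (forall n, measurableR (fn n)) -> integrableR g ->
  (forall s, fn n s @[n --> \oo] --> f s) -> (forall n s, `|fn n s| <= g s) ->
  \int[mu]_s fn n s @[n --> \oo] --> \int[mu]_s f s.
Proof.
move=> mfn gi fnf fng.
have mf : measurableR f.
  by apply: (measurable_fun_cvg mfn) => // s _; exact: fnf.
have [] // := @dominated_convergence _ _ _ mu setT measurableT
  (fun n => EFin \o fn n) (EFin \o f) (EFin \o g) _ _ _ gi _.
- by move=> n; apply: (measurable_EFinP _ (fn n)).2; exact: mfn.
- exact: (measurable_EFinP _ f).2.
- by apply: aeW => s _ /=; apply: cvg_EFin; [exact: nearW|exact: fnf].
- by apply: aeW => s n _ /=; rewrite lee_fin.
move=> fi _ h; apply: fine_cvg; rewrite fineK; last exact: integrable_fin_num.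
exact: h.
Qed.

Lemma Rintegral_derive (F f : R -> R) a b : (forall x : R, is_derive x 1 F (f x)) ->
  continuous f -> a <= b -> \int[mu]_(s in `[a, b]) f s = F b - F a.
Proof.
move=> dF cf; rewrite le_eqVlt => /predU1P[<-|ab].
  by rewrite set_itv1 Rintegral_set1 subrr.
have cF := is_derive_continuous dF.
rewrite /Rintegral (continuous_FTC2 ab (F := F))//.
- exact: continuous_subspaceT.
- split; first by move=> x _; case: (dF x).
  + exact/cvg_at_right_filter/cF.
  + exact/cvg_at_left_filter/cF.
- by move=> x _; rewrite (is_derive1_derive1 dF).
Qed.

End RealIntegral.

(** * Test functions *)

Section TestFunctions.
Context {R : realType}.
Implicit Types (u f g phi psi : R -> R) (a b : R).
Notation mu := (@lebesgue_measure R).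

(** For subsets of the line, compactness of the closure is boundedness. *)
Lemma test_functionP phi : test_function phi <->
  smooth phi /\ exists M, forall x, M < `|x| -> phi x = 0.
Proof.
split=> [[/smoothP sp] /compact_bounded [M [_ hM]]|[sp [M hM]]].
  split=> //; exists (M + 1) => x Mx; apply/eqP; apply: contraPT Mx => px0.
  by apply/negP; rewrite -leNgt; apply: (hM (M + 1)); [lra|exact: subset_closure].
split; first exact/smoothP.
apply: (@subclosed_compact _ _ `[- M, M]%classic).
- exact: closed_closure.
- exact: segment_compact.
- rewrite closureE => y; apply; split; first exact: itv_closed.
  move=> x /= px0; rewrite in_itv/= -ler_norml leNgt; apply/negP => /hM px.
  by rewrite px eqxx in px0.
Qed.

Lemma test_lin a b phi psi : test_function phi -> test_function psi ->
  test_function (fun s => a * phi s + b * psi s).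
Proof.
move=> /test_functionP[sp [M hM]] /test_functionP[sq [N hN]].
apply/test_functionP; split; first exact: smooth_lin.
exists (Num.max M N) => x; rewrite gt_max => /andP[Mx Nx].
by rewrite hM// hN// !mulr0 addr0.
Qed.

Lemma test_derive1 phi : test_function phi -> test_function (derive1 phi).
Proof.
move=> /test_functionP[sp [M hM]]; apply/test_functionP.
split; first exact: smooth_derive1.
exists M => x Mx; rewrite derive1E.
have := is_derive_cst (0 : R) x (1 : R) => /(near_eq_is_derive (g := phi)) [|_ //].
near=> y; rewrite hM//; near: y.
have oM : open [set y : R | M < `|y|].
  by apply: (open_comp (f := @Num.norm _ R) (D := [set z | M < z])) => [y _|];
    [exact: norm_continuous|exact: open_gt].
exact: (open_nbhs_nbhs (conj oM Mx)).
Unshelve. all: by end_near. Qed.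

Lemma test_shift c phi : test_function phi -> test_function (fun s => phi (s + c)).
Proof.
move=> /test_functionP[sp [M hM]]; apply/test_functionP; split.
  have := smooth_affine 1 c sp; congr smooth; apply/funext => x.
  by rewrite mul1r.
exists (M + `|c|) => x Mx; apply: hM.
by have := ler_normB (x + c) c; rewrite addrK; lra.
Qed.

Lemma test_smooth phi : test_function phi -> smooth phi.
Proof. by case/test_functionP. Qed.

Lemma test_continuous phi : test_function phi -> continuous phi.
Proof. by move=> /test_smooth /smooth_continuous. Qed.

Lemma test_support phi : test_function phi ->
  exists2 M, 0 <= M & forall s, ~ `[- M, M]%classic s -> phi s = 0.
Proof.
move=> /test_functionP[_ [M hM]]; exists (Num.max M 0).
  by rewrite le_max lexx orbT.
move=> s; rewrite /= in_itv/= -ler_norml => /negP; rewrite -ltNge gt_max => /andP[Ms _].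
exact: hM.
Qed.

Lemma test_bounded phi : test_function phi -> exists C, forall s, `|phi s| <= C.
Proof.
move=> tp; have [M M0 hM] := test_support tp.
have MM : - M <= M by lra.
have cn : {within `[- M, M], continuous (fun s => `|phi s|)}.
  apply: continuous_subspaceT => x; apply: cvg_norm; exact: test_continuous.
have [c cM hc] := EVT_max MM cn.
exists `|phi c| => s; have [sM|/negP sM] := boolP (s \in `[- M, M]%R); first exact: hc.
by rewrite (hM s)// normr0.
Qed.

Lemma integrableR_continuous_test f phi : continuous f -> test_function phi ->
  integrableR (fun s => f s * phi s).
Proof.
move=> cf tp; have [M _ hM] := test_support tp.
apply: (@integrableR_continuous _ _ (- M) M).
  by move=> x; apply: cvgM; [exact: cf|exact: test_continuous].
by move=> s /hM ->; rewrite mulr0.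
Qed.

Lemma integrable_locally_test g phi : locally_integrable setT g ->
  test_function phi -> integrableR (fun s => g s * phi s).
Proof.
move=> [mg _ lg] tp; have [M M0 hM] := test_support tp.
apply: (@integrableR_restrict _ `[- M, M]%classic) => //.
  by move=> s /hM ->; rewrite mulr0.
apply: (@eq_integrable _ _ _ mu _ _ ((EFin \o phi) \* (EFin \o g))%E) => //.
  by move=> s _ /=; rewrite mulrC.
apply: integrableMr => //.
- exact: measurable_funS (measurableR_continuous (test_continuous tp)).
- have [C hC] := test_bounded tp.
  exists C; split; first exact: num_real.
  by move=> D CD s _; exact: le_trans (hC s) (ltW CD).
- apply/integrableP; split.
    by apply: (measurable_EFinP _ g).2; exact: measurable_funS mg.
  by apply: lg => //; exact: segment_compact.
Qed.

(** The smooth approximations of the indicator of an interval against which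
    distributional identities are tested. *)
Lemma test_interval (H : R -> R) k a b : smooth H ->
  (forall x, x <= 0 -> H x = 0) -> (forall x, 1 <= x -> H x = 1) -> 0 < k ->
  test_function (fun s => 1 * H (k * s + - (k * a)) + - 1 * H (k * s + - (k * b))).
Proof.
move=> sH H0 H1 k0; apply/test_functionP.
split; first by apply: smooth_lin; exact: smooth_affine.
exists (`|a| + `|b| + k^-1) => x.
rewrite lter_normr => /orP[] hx.
  have ax : k^-1 <= x - a.
    by have := ler_norm a; have := normr_ge0 b; lra.
  have bx : k^-1 <= x - b.
    by have := ler_norm b; have := normr_ge0 a; lra.
  rewrite -!mulrBr !H1; first by lra.
    by rewrite -ler_pdivrMl// mulr1.
  by rewrite -ler_pdivrMl// mulr1.
have ik : 0 < k^-1 by rewrite invr_gt0.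
have ax : x <= a.
  by have := ler_norm (- a); rewrite normrN; have := normr_ge0 b; lra.
have bx : x <= b.
  by have := ler_norm (- b); rewrite normrN; have := normr_ge0 a; lra.
by rewrite -!mulrBr !H0 ?pmulr_rle0 ?subr_le0//; lra.
Qed.

(** The weights k H'(k (s - a)) are nonnegative, have integral 1 and live on
    [a, a + 1/k], so integration against them averages u near a. *)
Lemma approximate_identity (H : R -> R) u a : smooth H ->
  (forall x, 0 <= derive1 H x) ->
  (forall x, (x <= 0) || (1 <= x) -> derive1 H x = 0) ->
  (forall x, x <= 0 -> H x = 0) -> (forall x, 1 <= x -> H x = 1) ->
  continuous u ->
  (forall k, 0 < k -> integrableR (fun s => u s * (k * derive1 H (k * s + - (k * a))))) /\
  \int[mu]_s (u s * (n.+1%:R * derive1 H (n.+1%:R * s + - (n.+1%:R * a))))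
     @[n --> \oo] --> u a.
Proof.
move=> sH dH0 dH H0 H1 cu.
pose w k s := k * derive1 H (k * s + - (k * a)).
have cw k : continuous (w k).
  apply: smooth_continuous.
  have := smooth_lin k 0 (smooth_affine k (- (k * a)) (smooth_derive1 sH))
    (smooth_affine k (- (k * a)) (smooth_derive1 sH)).
  by congr smooth; apply/funext => s; rewrite mul0r addr0.
have cuw k : continuous (fun s => u s * w k s).
  by move=> s; apply: cvgM; [exact: cu|exact: cw].
have w0 k s : 0 < k -> 0 <= w k s by move=> /ltW k0; rewrite mulr_ge0.
have wout k s : 0 < k -> (s <= a) || (a + k^-1 <= s) -> w k s = 0.
  move=> k0 sP; rewrite /w -mulrBr dH ?mulr0//.
  case/orP: sP => sP; apply/orP; [left|right].
    by rewrite pmulr_rle0// subr_le0.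
  by rewrite -ler_pdivrMl// mulr1; lra.
have wout1 k s : 0 < k -> ~ `[a, a + k^-1]%classic s -> w k s = 0.
  move=> k0; rewrite /= in_itv/= => /negP; rewrite negb_and -!ltNge => /orP h.
  by apply: wout => //; apply/orP; case: h => /ltW; [left|right].
have iuw k : 0 < k -> integrableR (fun s => u s * w k s).
  move=> k0; apply: (@integrableR_continuous _ _ a (a + k^-1)) => // s /wout1 ->//.
  by rewrite mulr0.
split; first exact: iuw.
apply/cvgrPdist_le => e e0.
have := cu a; move/cvgrPdist_le/(_ _ e0) => [d /= d0 hd].
near=> n.
have : (n.+1%:R : R)^-1 < d.
  by near: n; exact: (near_infty_natSinv_lt (PosNum d0)).
have : 0 < n.+1%:R :> R by rewrite ltr0n.
move: (n.+1%:R) => k k0 kd.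
have ik0 : 0 < k^-1 by rewrite invr_gt0.
have aak : a <= a + k^-1 by rewrite lerDl ltW.
rewrite -(@Rintegral_restrict _ `[a, a + k^-1]%classic); last first.
  by move=> s /wout1; rewrite /w => -> //; rewrite mulr0.
have dHk (x : R) : is_derive x 1 (fun s => H (k * s + - (k * a))) (w k x).
  by apply: is_derive_affine; exact: smooth_is_derive1.
have W1 : \int[mu]_(s in `[a, a + k^-1]) w k s = 1.
  rewrite (Rintegral_derive dHk)// mulrDr mulfV ?gt_eqF//.
  by rewrite addrAC subrr add0r H1// H0// subr0.
have iw : mu.-integrable `[a, a + k^-1] (EFin \o w k) by exact: continuous_integrable.
have cst_w c : \int[mu]_(s in `[a, a + k^-1]) (c * w k s) = c.
  by rewrite RintegralZl// W1 mulr1.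
have ciw c : mu.-integrable `[a, a + k^-1] (EFin \o (fun s => c * w k s)).
  by apply: continuous_integrable => s; apply: cvgM; [exact: cvg_cst|exact: cw].
have iuw1 := continuous_integrable a (a + k^-1) (cuw k).
have near_a s : `[a, a + k^-1]%classic s -> `|u a - u s| <= e.
  rewrite /= in_itv/= => /andP[as1 as2]; apply: hd => /=.
  by rewrite distrC ger0_norm ?subr_ge0//; lra.
rewrite distrC ler_distl; apply/andP; split.
  rewrite -[leLHS]cst_w; apply: le_Rintegral => // s /near_a.
  by rewrite ler_distl => /andP[h1 h2]; rewrite ler_wpM2r ?w0//; lra.
rewrite -[leRHS]cst_w; apply: le_Rintegral => // s /near_a.
by rewrite ler_distl => /andP[h1 h2]; rewrite ler_wpM2r ?w0//; lra.
Unshelve. all: by end_near. Qed.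

End TestFunctions.

(** * The fundamental theorem of calculus for distributional derivatives *)

Section DistributionalDerivative.
Context {R : realType}.
Implicit Types (u f g phi : R -> R) (a b x s t : R).
Notation mu := (@lebesgue_measure R).

Lemma locally_integrable_itv g a b : locally_integrable setT g ->
  mu.-integrable `[a, b] (EFin \o g).
Proof.
move=> [mg _ lg]; apply/integrableP; split.
  by apply: (measurable_EFinP _ g).2; exact: measurable_funS mg.
by apply: lg => //; exact: segment_compact.
Qed.

(** Test the definition with smooth approximations of the indicator of ]a, b]:
    on one side their derivatives concentrate at the end points, on the other
    side dominated convergence produces the integral of g. *)
Lemma distr_deriv_FTC u g a b : continuous u -> is_distr_deriv u g -> a <= b ->
  \int[mu]_(s in `[a, b]) g s = u b - u a.
Proof.
move=> cu [lg ug] ab.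
have [H [sH dH0 dH H0 H1]] := smooth_step (R := R).
have Hmono x y : x <= y -> H x <= H y.
  move=> xy; have [c [_ _]] := mean_value (smooth_is_derive1 sH) xy.
  by rewrite -subr_ge0 => ->; rewrite mulr_ge0 ?subr_ge0.
have Hge0 x : 0 <= H x by have [/H0 ->//|x0] := leP x 0; rewrite -(H0 0)// Hmono// ltW.
have Hle1 x : H x <= 1 by have [x1|/H1 ->//] := ltP x 1; rewrite -(H1 1)// Hmono// ltW.
pose k n : R := n.+1%:R.
have k0 n : 0 < k n by rewrite ltr0n.
pose phi n s := 1 * H (k n * s + - (k n * a)) + - 1 * H (k n * s + - (k n * b)).
have tphi n : test_function (phi n) by exact: test_interval.
have dphi n (s : R) : is_derive s 1 (phi n)
    (1 * (k n * derive1 H (k n * s + - (k n * a))) +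
     - 1 * (k n * derive1 H (k n * s + - (k n * b)))).
  by apply: is_derive_lin; apply: is_derive_affine; exact: smooth_is_derive1.
have [ia ca] := approximate_identity a sH dH0 dH H0 H1 cu.
have [ib cb] := approximate_identity b sH dH0 dH H0 H1 cu.
have lhs : \int[mu]_s (u s * derive1 (phi n) s) @[n --> \oo] --> 1 * u a + - 1 * u b.
  have -> : (fun n => \int[mu]_s (u s * derive1 (phi n) s)) =
     (fun n => 1 * \int[mu]_s (u s * (k n * derive1 H (k n * s + - (k n * a)))) +
     - 1 * \int[mu]_s (u s * (k n * derive1 H (k n * s + - (k n * b))))).
    apply/funext => n.
    rewrite -(Rintegral_lin 1 (- 1) (ia _ (k0 n)) (ib _ (k0 n))).
    by apply: eq_Rintegral => s _; rewrite (is_derive1_derive1 (dphi n)); ring.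
  by apply: cvgD; apply: cvgM => //; exact: cvg_cst.
pose chi : R -> R := \1_(`]a, b]%classic : set R).
have phi_chi s : phi n s @[n --> \oo] --> chi s.
  have large t : t < s -> \forall n \near \oo, H (k n * s + - (k n * t)) = 1.
    move=> ts; have st : 0 < s - t by rewrite subr_gt0.
    near=> n; apply: H1; rewrite -mulrBr -ler_pdivrMl// mulr1.
    by apply: ltW; rewrite /k; near: n; exact: (near_infty_natSinv_lt (PosNum st)).
  have small t n : s <= t -> H (k n * s + - (k n * t)) = 0.
    by move=> st; rewrite H0// -mulrBr pmulr_rle0// subr_le0.
  apply: cvg_near_cst; rewrite /chi indicE.
  have [sa|as_] := leP s a.
    apply: nearW => n; rewrite /phi !small//; last exact: le_trans ab.
    by rewrite memNset ?mulr0 ?addr0//= in_itv/= ltNge sa.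
  have [sb|bs] := leP s b.
    near=> n; rewrite /phi (small b)// mulr0 addr0 mul1r mem_set/=; last first.
      by rewrite in_itv/= as_ sb.
    by near: n; exact: large.
  near=> n; rewrite /phi memNset/=; last by rewrite in_itv/= leNgt bs andbF.
  have -> : H (k n * s + - (k n * a)) = 1 by near: n; exact: large.
  have -> : H (k n * s + - (k n * b)) = 1 by near: n; exact: large.
  by rewrite !mulr1 subrr.
have ig := locally_integrable_itv a (b + 1) lg.
have rhs : \int[mu]_s (g s * phi n s) @[n --> \oo] --> \int[mu]_s (g s * chi s).
  apply: (@Rintegral_dominated _ _ _ (fun s => `|(g \_ `[a, b + 1]) s|)).
  - move=> n; apply: measurable_funM; first by case: lg.
    exact: measurableR_continuous (test_continuous (tphi n)).
  - apply: (@integrable_norm _ _ _ mu); apply: (@integrableR_restrict _ `[a, b + 1]%classic) => //.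
      by move=> s sP; rewrite patchE memNset.
    by apply: eq_integrable ig => // s sP; rewrite /= patchE sP.
  - by move=> s; apply: cvgM; [exact: cvg_cst|exact: phi_chi].
  - move=> n s; rewrite patchE; case: ifPn => [_|/negP sab].
      rewrite normrM ler_piMr// ler_norml.
      have := Hge0 (k n * s + - (k n * a)); have := Hle1 (k n * s + - (k n * a)).
      have := Hge0 (k n * s + - (k n * b)); have := Hle1 (k n * s + - (k n * b)).
      by rewrite /phi; lra.
    suff -> : phi n s = 0 by rewrite mulr0 !normr0.
    have : (s <= a) || (b + 1 <= s).
      apply: contraPT sab; rewrite negb_or -!ltNge => /andP[as_ sb].
      by apply; rewrite inE/= in_itv/= !ltW.
    have kn1 : 1 <= k n by rewrite /k ler1n.
    case/orP => sP; rewrite /phi -!mulrBr.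
      have sb : s <= b by exact: le_trans ab.
      by rewrite !H0 ?pmulr_rle0 ?subr_le0//; lra.
    by rewrite !H1; [lra|nra|nra].
have := cvgN rhs.
have -> : - (fun n => \int[mu]_s (g s * phi n s)) =
    (fun n => \int[mu]_s (u s * derive1 (phi n) s)).
  by apply/funext => n; rewrite ug//.
move=> rhs'; have := cvg_unique (@Rhausdorff R) lhs (rhs' _).
have -> : \int[mu]_s (g s * chi s) = \int[mu]_(s in `[a, b]) g s.
  rewrite -Rintegral_itv_obnd_cbnd.
    rewrite [RHS]Rintegral_mkcond; apply: eq_Rintegral => s _.
    by rewrite patchE /chi indicE; case: ifP; rewrite ?mulr1 ?mulr0.
  apply: integrableS (locally_integrable_itv a b lg) => //.
  exact: subset_itv_oc_cc.
by move=> /(_ _ _); rewrite mul1r mulN1r => h; rewrite -[LHS]opprK -h opprB.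
Unshelve. all: by end_near. Qed.

(** The du Bois-Reymond lemma: a function orthogonal to all test functions has
    vanishing integrals over intervals, so it vanishes at its Lebesgue points. *)
Lemma du_bois_reymond f : locally_integrable setT f ->
  (forall phi, test_function phi -> \int[mu]_s (f s * phi s) = 0) ->
  {ae mu, forall x, f x = 0}.
Proof.
move=> lf hf.
have d0 : is_distr_deriv (cst 0) f.
  split=> // phi tphi; rewrite hf// oppr0 (@eq_Rintegral _ _ _ _ _ (cst 0)).
    by rewrite Rintegral_cst// mul0r.
  by move=> s _; rewrite /= mul0r.
have int0 a b : a <= b -> \int[mu]_(s in `[a, b]) f s = 0.
  move=> ab; rewrite (distr_deriv_FTC _ d0 ab) ?subrr//; exact: cst_continuous.
have := lebesgue_differentiation lf.
apply: filterS; first exact: (ae_filter_ringOfSetsType mu).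
move=> x fx.

have iab := locally_integrable_itv (x - 1) (x + 1) lf.
have xx1 : x < x + 1 by rewrite ltrDl.
(* The primitive of f based at x - 1 vanishes identically near x. *)
have x1x : (ereal_of_itv_bound (BLeft (x - 1)%R) < BRight x)%E.
  by rewrite /= (@lte_fin R) ltrBlDr ltrDl.
have [dF <-] := FTC1_lebesgue_pt xx1 iab x1x fx.
rewrite derive1E.
suff dF0 : is_derive x 1 (fun y : R => \int[mu]_(t in `[x - 1, y]) f t) 0.
  by case: dF0.
apply: (@near_eq_is_derive _ _ _ (cst 0) _ x 1 0).
near=> y; rewrite int0//; apply: ltW; near: y; apply: lt_nbhsr.
by rewrite ltrBlDr ltrDl.
Unshelve. all: by end_near. Qed.

End DistributionalDerivative.

(** * Square-integrable functions *)

Section SquareIntegrable.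
Context {R : realType}.
Implicit Types (f g h phi : R -> R) (a b c x s t : R).
Notation mu := (@lebesgue_measure R).

Lemma L2P f : L2 f <-> measurableR f /\ integrableR (fun s => f s ^+ 2).
Proof.
split=> [Lf|[mf f2]].
  split; last exact: Lfun2_integrable_sqr.
  by move: Lf; rewrite /L2/= inE => /andP[/[!inE]].
rewrite /L2/= inE; apply/andP; split; rewrite inE//=.
rewrite /finite_norm unlock /Lnorm poweR_lty//.
have /integrableP[_] := f2; apply: le_lt_trans.
rewrite le_eqVlt; apply/orP; left; apply/eqP/eq_integral => s _ /=.
by rewrite powR_mulrn// normrX.
Qed.

Lemma L2_measurable f : L2 f -> measurableR f.
Proof. by case/L2P. Qed.

(** The inner product of L^2. *)
Definition ip f g := \int[mu]_s (f s * g s).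

Lemma L2M f g : L2 f -> L2 g -> integrableR (fun s => f s * g s).
Proof.
move=> /L2P[mf f2] /L2P[mg g2].
apply: le_integrableR (integrableR_lin 1 1 f2 g2) _.
  exact: measurable_funM.
by move=> s; rewrite ler_norml; apply/andP; split; nra.
Qed.

Lemma L2_sqr f : L2 f -> integrableR (fun s => f s * f s).
Proof. by move=> Lf; exact: L2M. Qed.

Lemma L2_lin a b f g : L2 f -> L2 g -> L2 (fun s => a * f s + b * g s).
Proof.
move=> Lf Lg; apply/L2P; split.
  by apply: measurable_funD; apply: measurable_funM => //; exact: L2_measurable.
have := integrableR_lin 1 (2 * a * b)
  (integrableR_lin (a ^+ 2) (b ^+ 2) (L2_sqr Lf) (L2_sqr Lg)) (L2M Lf Lg).
by apply: eq_integrable => // s _ /=; congr EFin; ring.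
Qed.

Lemma L2B f g : L2 f -> L2 g -> L2 (f \- g).
Proof.
move=> Lf Lg; have := L2_lin 1 (- 1) Lf Lg.
by congr L2; apply/funext => s /=; rewrite mul1r mulN1r.
Qed.

Lemma ipC f g : ip f g = ip g f.
Proof. by apply: eq_Rintegral => s _; rewrite mulrC. Qed.

Lemma ip_linl a b f g h : L2 f -> L2 g -> L2 h ->
  ip (fun s => a * f s + b * g s) h = a * ip f h + b * ip g h.
Proof.
move=> Lf Lg Lh; rewrite -(Rintegral_lin a b (L2M Lf Lh) (L2M Lg Lh)).
by apply: eq_Rintegral => s _; ring.
Qed.

Lemma ip_linr a b f g h : L2 f -> L2 g -> L2 h ->
  ip h (fun s => a * f s + b * g s) = a * ip h f + b * ip h g.
Proof. by move=> Lf Lg Lh; rewrite ipC ip_linl// ![ip _ h]ipC. Qed.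

Lemma ip_ge0 f : 0 <= ip f f.
Proof. by apply: Rintegral_ge0 => s _; rewrite -expr2 sqr_ge0. Qed.

Lemma ip_lin_sqr a b f g : L2 f -> L2 g ->
  ip (fun s => a * f s + b * g s) (fun s => a * f s + b * g s) =
  a ^+ 2 * ip f f + 2 * a * b * ip f g + b ^+ 2 * ip g g.
Proof.
move=> Lf Lg; have Lfg := L2_lin a b Lf Lg.
by rewrite ip_linl// !ip_linr// [ip g f]ipC; ring.
Qed.

(** The discriminant criterion gives the Cauchy-Schwarz inequality, and later
    the first-order condition at an approximate minimiser. *)
Lemma nonneg_quadratic (A B C : R) :
  (forall t, 0 <= A * t ^+ 2 + 2 * B * t + C) -> B ^+ 2 <= A * C.
Proof.
move=> h; have C0 : 0 <= C by have := h 0; rewrite expr0n/= !mulr0 !add0r.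
have [A0|A0|A0] := ltrgtP A 0.
- exfalso; have := h (1 + (2 * `|B| + C) / - A).
  have nB := ler_norm B; have nB0 := normr_ge0 B.
  set q := _ / - A; have q0 : 0 <= q by rewrite divr_ge0; lra.
  have Aq : A * q = - (2 * `|B| + C).
    by rewrite /q mulrA; field; rewrite lt_eqF.
  have -> : A * (1 + q) ^+ 2 + 2 * B * (1 + q) + C =
    A + A * q + (A * q + 2 * B) * (1 + q) + C by ring.
  rewrite Aq; nra.
- have := h (- B / A); have -> : A * (- B / A) ^+ 2 + 2 * B * (- B / A) + C =
    (A * C - B ^+ 2) / A by field; rewrite gt_eqF.
  by rewrite pmulr_lge0 ?invr_gt0// subr_ge0.
- have [->|B0] := eqVneq B 0; first by rewrite expr0n/= A0 mul0r.
  exfalso; have := h (- (C + 1) / (2 * B)); rewrite A0.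
  have -> : 0 * (- (C + 1) / (2 * B)) ^+ 2 + 2 * B * (- (C + 1) / (2 * B)) + C = - 1.
    by field.
  by rewrite lerNr oppr0 ler10.
Qed.

Lemma cauchy_schwarz f g : L2 f -> L2 g -> ip f g ^+ 2 <= ip f f * ip g g.
Proof.
move=> Lf Lg; apply: nonneg_quadratic => t.
have := ip_ge0 (fun s => t * f s + 1 * g s).
by rewrite ip_lin_sqr// expr1n; congr (0 <= _); ring.
Qed.

Lemma L2_test phi : test_function phi -> L2 phi.
Proof.
move=> tphi; have cphi := test_continuous tphi; apply/L2P; split.
  exact: measurableR_continuous.
have := integrableR_continuous_test cphi tphi.
by apply: eq_integrable => // s _; rewrite /= expr2.
Qed.

Lemma L2_locally_integrable f : L2 f -> locally_integrable setT f.
Proof.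
move=> /L2P[mf f2]; split; [exact: mf|exact: openT|move=> K _ cK].
have mK : measurable (K : set (measurableTypeR R)) := compact_measurable cK.
have muK : (mu K < +oo)%E by exact: compact_finite_measure.
have iK : mu.-integrable K (EFin \o (fun s => 1 + f s ^+ 2)).
  have i1 : mu.-integrable K (EFin \o cst 1).
    apply: measurable_bounded_integrable => //.
    by exists 1; split => // M M1 s _; rewrite /= normr1 ltW.
  have i2 : mu.-integrable K (EFin \o (fun s => f s ^+ 2)).
    exact: integrableS f2.
  by have := integrableD mK i1 i2; exact: eq_integrable.
have /integrableP[_] := iK; apply: le_lt_trans.
apply: ge0_le_integral => //.
- apply: (measurable_EFinP _ (fun s => `|f s|)).2.
  by apply: measurableT_comp => //; exact: measurable_funS mf.
- by have /measurable_int := integrable_abse iK.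
move=> s _; rewrite lee_fin/=.
apply: le_trans (ler_norm _); rewrite -(real_normK (num_real (f s))).
by have := sqr_ge0 (`|f s| - 1); nra.
Qed.

Lemma Rintegral_EFin f : integrableR f -> (\int[mu]_s (f s)%:E)%E = (\int[mu]_s f s)%:E.
Proof. by move=> fi; rewrite /Rintegral fineK//; exact: integrable_fin_num. Qed.

Lemma ae_eq_Rintegral f g : measurableR f -> measurableR g ->
  {ae mu, forall s, f s = g s} -> \int[mu]_s f s = \int[mu]_s g s.
Proof.
move=> mf mg fg; rewrite /Rintegral; congr fine; apply: ae_eq_integral => //.
- exact: (measurable_EFinP _ f).2.
- exact: (measurable_EFinP _ g).2.
- move: fg; apply: filterS; first exact: (ae_filter_ringOfSetsType mu).
  by move=> s -> _.
Qed.

Lemma ae_eq_integrableR f g : measurableR f -> integrableR g ->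
  {ae mu, forall s, f s = g s} -> integrableR f.
Proof.
move=> mf ig fg; apply/integrableP; split; first exact: (measurable_EFinP _ f).2.
have /integrableP[mg] := ig; apply: le_lt_trans.
rewrite le_eqVlt; apply/orP; left; apply/eqP.
apply: ae_eq_integral => //.
- by apply: measurableT_comp => //; exact: (measurable_EFinP _ f).2.
- exact: measurableT_comp.
- move: fg; apply: filterS; first exact: (ae_filter_ringOfSetsType mu).
  by move=> s /= -> _.
Qed.

End SquareIntegrable.

(** * Completeness *)

Section Completeness.
Context {R : realType}.
Implicit Types (f g h : R -> R) (a b c x s t : R).
Notation mu := (@lebesgue_measure R).

(** Lower semicontinuity of the norm under convergence almost everywhere. *)
Lemma L2_fatou (h : nat -> R -> R) k C : (forall m, L2 (h m)) -> measurableR k ->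
  {ae mu, forall s, h m s @[m --> \oo] --> k s} ->
  (forall m, ip (h m) (h m) <= C) -> L2 k /\ ip k k <= C.
Proof.
move=> Lh mk hk hC.
have mh2 m : measurableR (fun s => h m s ^+ 2).
  by apply: measurable_funX; exact: L2_measurable.
have mk2 : measurableR (fun s => k s ^+ 2) by exact: measurable_funX.
have h0 m s : (0 <= (h m s ^+ 2)%:E)%E by rewrite lee_fin sqr_ge0.
have bound : (\int[mu]_s (k s ^+ 2)%:E <= C%:E)%E.
  have := @fatou _ _ _ mu setT measurableT (fun m s => (h m s ^+ 2)%:E)
    (fun m => (measurable_EFinP _ (fun s => h m s ^+ 2)).2 (mh2 m)) (fun m s _ => h0 m s).
  rewrite (@ae_eq_integral _ _ _ mu setT (fun s => (k s ^+ 2)%:E)) //.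
  - move=> /le_trans; apply; rewrite limn_einf_lim; apply: lime_le.
      exact: is_cvg_einfs.
    apply: nearW => m; apply: le_trans (_ : _ <= \int[mu]_s (h m s ^+ 2)%:E)%E _.
      by apply: ereal_inf_lbound; exists m => /=.
    rewrite Rintegral_EFin ?lee_fin; last exact: ((L2P _).1 (Lh m)).2.
    by have := hC m; congr (_ <= _); apply: eq_Rintegral => s _; rewrite expr2.
  - rewrite [X in measurable_fun _ X](_ : _ = -%E \o
        (fun s => limn_esup (fun m => (- (h m s ^+ 2))%:E))); last first.
      apply/funext => s /=; rewrite -limn_einfN; congr limn_einf.
      by apply/funext => m /=; rewrite opprK.
    apply: measurableT_comp; first exact: oppe_measurable.
    apply: measurable_fun_limn_esup => m.
    apply: (measurable_EFinP _ (fun s => - (h m s ^+ 2))).2.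
    by have := measurable_funN (mh2 m).
  - exact: (measurable_EFinP _ (fun s => k s ^+ 2)).2.
  - move: hk; apply: filterS; first exact: (ae_filter_ringOfSetsType mu).
    move=> s hs _; apply: (cvg_limn_einf_sup _).1.
    apply: cvg_EFin; first exact: nearW.
    by rewrite expr2; under eq_fun do rewrite expr2; exact: cvgM.
have ik : integrableR (fun s => k s ^+ 2).
  apply/integrableP; split; first exact: (measurable_EFinP _ (fun s => k s ^+ 2)).2.
  apply: le_lt_trans (ltry C); apply: le_trans bound.
  rewrite le_eqVlt; apply/orP; left; apply/eqP/eq_integral => s _ /=.
  by rewrite ger0_norm// sqr_ge0.
split; first exact/L2P.
by move: bound; rewrite Rintegral_EFin// lee_fin.
Qed.

Lemma geometric_partial_sum n : \sum_(0 <= k < n) (4 : R) ^- k <= 2 - 2 * 4 ^- n.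
Proof.
elim: n => [|n IH]; first by rewrite big_geq// expr0 invr1 mulr1 subrr.
rewrite big_nat_recr//= exprS invfM.
have : 0 < 4 ^- n :> R by rewrite invr_gt0 exprn_gt0.
by move: IH; move: (4 ^- n) (\sum_(_ <= _ < _) _) => q S; lra.
Qed.

(** The Riesz-Fischer theorem, for sequences that are Cauchy at a geometric
    rate: the rate 16^-n leaves room for the weights 4^n, so that the weighted
    series S of the squared increments is integrable, hence finite almost
    everywhere; and where S is finite the increments are summable. *)
Lemma L2_complete (f : nat -> R -> R) : (forall n, L2 (f n)) ->
  (forall n m, (n <= m)%N -> ip (f m \- f n) (f m \- f n) <= 16 ^- n) ->
  exists g, L2 g /\ forall n, ip (g \- f n) (g \- f n) <= 16 ^- n.
Proof.
move=> Lf fC.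

pose d n s := 4 ^+ n * (f n.+1 s - f n s) ^+ 2.
have d0 n s : 0 <= d n s by apply: mulr_ge0; [exact: exprn_ge0|exact: sqr_ge0].
have mdiff n : L2 (f n.+1 \- f n) by exact: L2B.
have md n : measurableR (d n).
  have m2 := measurable_funX 2 (L2_measurable (mdiff n)).
  have m4 : measurableR (cst (4 ^+ n) : R -> R) by exact: measurable_cst.
  by have := measurable_funM m4 m2.
have mdE n : measurable_fun (setT : set (measurableTypeR R)) ((fun n s => (d n s)%:E) n).
  exact: (measurable_EFinP _ (d n)).2 (md n).
pose S s := (\sum_(0 <= n <oo) (d n s)%:E)%E.
have mS : measurable_fun (setT : set (measurableTypeR R)) S.
  have := @ge0_emeasurable_sum _ (measurableTypeR R) R setT
    (fun n s => (d n s)%:E) xpredT.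
  by apply => // n s _ _; rewrite lee_fin.
have S0 s : (0 <= S s)%E by apply: nneseries_ge0 => n _ _; rewrite lee_fin.
have intS : (\int[mu]_s S s <= 2%:E)%E.
  rewrite integral_nneseries//; last by move=> n s _; rewrite lee_fin.
  apply: le_trans (_ : _ <= \sum_(0 <= n <oo) (4 ^- n : R)%:E)%E _.
    apply: lee_nneseries => [n _ _|n _].
      by apply: integral_ge0 => s _; rewrite lee_fin.
    rewrite Rintegral_EFin; last first.
      have := integrableZl measurableT (4 ^+ n) (L2_sqr (mdiff n)).
      by apply: eq_integrable => // s _ /=; rewrite /d expr2.
    rewrite lee_fin /d RintegralZl//; last exact: (L2_sqr (mdiff n)).
    have := fC n n.+1 (leqnSn n); rewrite /ip => h.
    have -> : (4 : R) ^- n = 4 ^+ n * 16 ^- n.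
      have -> : (16 : R) = 4 * 4 by lra.
      by rewrite exprMn invfM mulrA mulfV ?mul1r// expf_neq0.
    by rewrite ler_wpM2l// exprn_ge0.
  apply: lime_le.
    by apply: is_cvg_nneseries => n _ _; rewrite lee_fin invr_ge0 exprn_ge0.
  apply: nearW => n; rewrite sumEFin lee_fin.
  apply: le_trans (geometric_partial_sum n) _.
  by rewrite gerDl oppr_le0 mulr_ge0// invr_ge0 exprn_ge0.
have iS : mu.-integrable setT S.
  apply/integrableP; split => //; apply: le_lt_trans (ltry 2).
  by under eq_integral do rewrite gee0_abs//.
have cvg_f s : (S s < +oo)%E -> cvgn (f ^~ s).
  move=> Sfin.
  pose u n := f n.+1 s - f n s.
  have fE : f ^~ s = (fun n => f 0%N s + series u n).
    apply/funext => n; rewrite seriesEnat/= telescope_sumr//; lra.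
  rewrite fE; apply: is_cvgD; first exact: is_cvg_cst.
  apply: normed_cvg; apply: nondecreasing_is_cvgn.
    by apply: nondecreasing_series => n _ _; exact: normr_ge0.
  exists (2 + fine (S s)) => _ [n _ <-].
  rewrite /normed_series_of seriesEnat/=.
  apply: le_trans (_ : _ <= \sum_(0 <= k < n) (4 ^- k + d k s)) _.
    apply: ler_sum => k _; rewrite /d /u; move: (f _ _ - f _ _) => v.
    have q0 : 0 < (2 : R) ^+ k by rewrite exprn_gt0.
    have -> : (4 : R) = 2 ^+ 2 by lra.
    rewrite -exprM mulnC exprM; move: (2 ^+ k) q0 => q q0.
    rewrite -(real_normK (num_real v)) -exprMn.
    (* The inequality of the means: |v| = q^-1 (q |v|) with q = 2^k. *)
    have := sqr_ge0 (q^-1 - q * `|v|).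
    have -> : (q^-1 - q * `|v|) ^+ 2 = q ^- 2 + (q * `|v|) ^+ 2 - 2 * `|v|.
      by field; rewrite gt_eqF.
    by have := normr_ge0 v; lra.
  rewrite big_split/=; apply: lerD.
    apply: le_trans (geometric_partial_sum n) _.
    by rewrite gerDl oppr_le0 mulr_ge0// invr_ge0 exprn_ge0.
  rewrite -lee_fin -sumEFin fineK; last by rewrite ge0_fin_numE.
  by apply: nneseries_lim_ge => k _ _; rewrite lee_fin.
pose A : set (measurableTypeR R) := [set s | (S s < +oo)%E].
have mA : measurable A.
  by have := emeasurable_fun_infty_o measurableT mS +oo%E; rewrite setTI.
(* Cutting off outside A makes the sequence converge everywhere, so that its
   limit is measurable. *)
pose F n s := f n s * \1_A s.
have mF n : measurableR (F n).
  apply: measurable_funM; first exact: L2_measurable.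
  exact: measurable_indic.
have cvgF s : F n s @[n --> \oo] --> limn (F ^~ s).
  rewrite /F indicE; have [sA|sA] := boolP (s \in A).
    apply: is_cvgM; last exact: is_cvg_cst.
    by apply: cvg_f; rewrite inE in sA.
  by under eq_fun do rewrite mulr0; exact: is_cvg_cst.
pose g s := limn (F ^~ s).
have mg : measurableR g.
  by apply: (measurable_fun_cvg mF) => s _; exact: cvgF.
have fg : {ae mu, forall s, f n s @[n --> \oo] --> g s}.
  have ae_fin : {ae mu, forall s, S s \is a fin_num}.
    have := integrable_ae measurableT iS.
    by congr (\forall s \near _, _); apply/funext => s; rewrite propeqE; split => [|//]; apply.
  move: ae_fin; apply: filterS; first exact: (ae_filter_ringOfSetsType mu).
  move=> s; rewrite ge0_fin_numE// => sA.
  rewrite (_ : f ^~ s = F ^~ s); first exact: cvgF.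
  by apply/funext => n; rewrite /F indicE mem_set// mulr1.
have key n : L2 (g \- f n) /\ ip (g \- f n) (g \- f n) <= 16 ^- n.
  apply: (@L2_fatou (fun m => f (m + n)%N \- f n)).
  - by move=> m; exact: L2B.
  - by apply: measurable_funB => //; exact: L2_measurable.
  - move: fg; apply: filterS; first exact: (ae_filter_ringOfSetsType mu).
    move=> s; rewrite -(cvg_shiftn n) => hs.
    by apply: cvgB; [exact: hs|exact: cvg_cst].
  - by move=> m; apply: fC; exact: leq_addl.
exists g; split; last by move=> n; case: (key n).
have := L2_lin 1 1 (key 0%N).1 (Lf 0%N).
by congr L2; apply/funext => s /=; lra.
Qed.

End Completeness.

(** * Riesz representation on test functions *)

Section RieszRepresentation.
Context {R : realType}.
Implicit Types (f g h phi psi : R -> R) (a b c x s t : R).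
Notation mu := (@lebesgue_measure R).

Lemma exists_inv_exp16_le (e : R) : 0 < e -> exists n, 16 ^- n <= e :> R.
Proof.
move=> e0; have : (16^-1 : R) ^+ n @[n --> \oo] --> (0 : R).
  by apply: cvg_expr; rewrite ger0_norm ?invr_ge0// invf_lt1// ltr1n.
move=> /cvgrPdist_le/(_ _ e0) [n _ /(_ n (leqnn n))] /=.
by rewrite sub0r normrN exprVn ger0_norm ?invr_ge0 ?exprn_ge0//; exists n.
Qed.

Lemma le_of_inv_exp16 (x y K : R) : (forall n, x <= y + K * 16 ^- n) -> x <= y.
Proof.
move=> h; apply/ler_addgt0Pr => e e0.
have K0 : 0 < `|K| + 1 by rewrite ltr_wpDl.
have [n hn] := exists_inv_exp16_le (divr_gt0 e0 K0).
apply: le_trans (h n) _; rewrite lerD2l.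
have q0 : 0 <= (16 : R) ^- n by rewrite invr_ge0 exprn_ge0.
apply: le_trans (_ : _ <= (`|K| + 1) * 16 ^- n) _.
  by rewrite ler_wpM2r//; have := ler_norm K; lra.
by rewrite mulrC -ler_pdivlMr.
Qed.

(** Minimising |phi|^2 - 2 ell(phi) over test functions represents ell by the
    L^2 limit of a minimising sequence, which is Cauchy by the parallelogram
    identity. That the representative is a limit of test functions also yields
    their density. *)
Lemma riesz_test (ell : (R -> R) -> R) C : 0 <= C ->
  (forall a b phi psi, test_function phi -> test_function psi ->
     ell (fun s => a * phi s + b * psi s) = a * ell phi + b * ell psi) ->
  (forall phi, test_function phi -> ell phi ^+ 2 <= C * ip phi phi) ->
  exists g, [/\ L2 g, forall phi, test_function phi -> ip g phi = ell phi,
    ip g g <= C &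
    forall e, 0 < e -> exists2 phi, test_function phi & ip (g \- phi) (g \- phi) <= e].
Proof.
move=> C0 lin bd.
pose J phi := ip phi phi - 2 * ell phi.
have JC phi : test_function phi -> - C <= J phi.
  move=> tphi; have := bd _ tphi; have := ip_ge0 phi; rewrite /J.
  move: (ip _ _) (ell _) => q l q0 lq; rewrite leNgt; apply/negP => h.
  have h1 : 0 < 2 * l - (C + q) by lra.
  have h2 : 0 < 2 * l + (C + q) by lra.
  by have := mulr_gt0 h1 h2; have := sqr_ge0 (C - q); nra.
pose V := [set J phi | phi in @test_function R].
have t0 : test_function (cst 0 : R -> R).
  by apply/test_functionP; split; [exact: smooth_cst|exists 0].
have V0 : has_inf V.
  split; first by exists (J (cst 0)); exists (cst 0).
  by exists (- C) => _ [phi tphi <-]; exact: JC.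
pose m := inf V.
have mJ phi : test_function phi -> m <= J phi.
  by move=> tphi; apply: ge_inf; [case: V0|exists phi].
have /choice[phi_ hphi] : forall n, exists phi,
    test_function phi /\ J phi <= m + 16 ^- n / 4.
  move=> n; have e0 : 0 < 16 ^- n / 4 :> R.
    by rewrite divr_gt0// invr_gt0 exprn_gt0.
  have [_ [phi tphi <-] h] := inf_adherent e0 V0.
  by exists phi; split=> //; exact: ltW.
have tphi n : test_function (phi_ n) by case: (hphi n).
have Jphi n : J (phi_ n) <= m + 16 ^- n / 4 by case: (hphi n).
have Lphi n : L2 (phi_ n) by exact: L2_test.
have subE f g : f \- g = (fun s => 1 * f s + - 1 * g s).
  by apply/funext => s /=; rewrite mul1r mulN1r.
have cauchy n k : (n <= k)%N ->
    ip (phi_ k \- phi_ n) (phi_ k \- phi_ n) <= 16 ^- n.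
  move=> nk; rewrite subE ip_lin_sqr//.
  have := mJ _ (test_lin 2^-1 2^-1 (tphi k) (tphi n)).
  rewrite /J ip_lin_sqr// lin//.
  have := Jphi n; have := Jphi k; rewrite /J.
  have : 16 ^- k <= 16 ^- n :> R.
    by rewrite lef_pV2 ?posrE ?exprn_gt0// ler_weXn2l// ler1n.
  have -> : (2^-1 : R) ^+ 2 = 4^-1 by field.
  have -> : 2 * 2^-1 * 2^-1 = 2^-1 :> R by field.
  move: (ip _ _) (ip _ _) (ip _ _) (ell _) (ell _) (16 ^- k) (16 ^- n).
  by move=> A B D l1 l2 p q; lra.
have [g [Lg hg]] := L2_complete Lphi cauchy.
have Lgphi n : L2 (g \- phi_ n) by exact: L2B.
have repr psi : test_function psi -> ip g psi = ell psi.
  move=> tpsi; have Lpsi := L2_test tpsi.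
  have small n : (ip g psi - ell psi) ^+ 2 <= 0 + 4 * ip psi psi * 16 ^- n.
    have h1 : (ip (phi_ n) psi - ell psi) ^+ 2 <= ip psi psi * (16 ^- n / 4).
      apply: nonneg_quadratic => t.
      have := mJ _ (test_lin 1 t (tphi n) tpsi); rewrite /J ip_lin_sqr// lin//.
      have := Jphi n; rewrite /J.
      by move: (ip _ _) (ip _ _) (ip _ _) (ell _) (ell _) => A B D l1 l2; nra.
    have h2 := cauchy_schwarz (Lgphi n) Lpsi.
    have := hg n; have := ip_ge0 psi; move: h2.
    rewrite [X in X ^+ 2](_ : _ = ip g psi - ip (phi_ n) psi); last first.
      by rewrite subE ip_linl// mul1r mulN1r.
    move: h1; move: (ip g psi) (ip (phi_ n) psi) (ip psi psi) (ell psi).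
    have : 0 <= (16 : R) ^- n by rewrite invr_ge0 exprn_ge0.
    move: (16 ^- n) (ip _ _) => q r q0 A B P l h1 h2 P0 rq.
    have : (A - B) ^+ 2 <= q * P by apply: le_trans h2 _; exact: ler_wpM2r.
    have -> : A - l = (A - B) + (B - l) by ring.
    by have := sqr_ge0 ((A - B) - (B - l)); nra.
  apply/eqP; rewrite -subr_eq0 -sqrf_eq0; apply/eqP/le_anti.
  by rewrite sqr_ge0 (le_of_inv_exp16 small).
exists g; split=> //.
  apply: (@le_of_inv_exp16 _ _ 1) => n.
  have := JC _ (tphi n); rewrite /J -repr//.
  have := hg n; rewrite subE ip_lin_sqr//.
  by move: (ip _ _) (ip _ _) (ip _ _) (16 ^- n) => A B D q; lra.
move=> e /exists_inv_exp16_le [n ne]; exists (phi_ n) => //.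
exact: le_trans (hg n) ne.
Qed.

Lemma L2_ae_eq f g : measurableR f -> L2 g -> {ae mu, forall s, f s = g s} -> L2 f.
Proof.
move=> mf /L2P[mg g2] fg; apply/L2P; split=> //.
apply: ae_eq_integrableR g2 _; first exact: measurable_funX.
move: fg; apply: filterS; first exact: (ae_filter_ringOfSetsType mu).
by move=> s ->.
Qed.

Lemma ip_ae_eq f f' g g' : L2 f -> L2 f' -> L2 g -> L2 g' ->
  {ae mu, forall s, f s = f' s} -> {ae mu, forall s, g s = g' s} -> ip f g = ip f' g'.
Proof.
move=> Lf Lf' Lg Lg' ff gg; apply: ae_eq_Rintegral.
- by apply: measurable_funM; exact: L2_measurable.
- by apply: measurable_funM; exact: L2_measurable.
- move: ff gg; apply: filterS2; first exact: (ae_filter_ringOfSetsType mu).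
  by move=> s -> ->.
Qed.

(** The functional <h, . > is represented by a limit of test functions, and
    this representative equals h almost everywhere. *)
Lemma test_dense h e : L2 h -> 0 < e ->
  exists2 phi, test_function phi & ip (h \- phi) (h \- phi) <= e.
Proof.
move=> Lh e0.
have [||g [Lg hg _ dense]] := @riesz_test (ip h) (ip h h) (ip_ge0 h).
- by move=> a b phi psi /L2_test ? /L2_test ?; exact: ip_linr.
- by move=> phi /L2_test ?; exact: cauchy_schwarz.

have hge : {ae mu, forall s, h s = g s}.
  have orth phi : test_function phi -> \int[mu]_s ((1 * h s + - 1 * g s) * phi s) = 0.
    move=> tphi; have Lphi := L2_test tphi.
    by have := ip_linl 1 (- 1) Lh Lg Lphi; rewrite hg// mul1r mulN1r subrr.
  have := du_bois_reymond (L2_locally_integrable (L2_lin 1 (- 1) Lh Lg)) orth.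
  apply: filterS; first exact: (ae_filter_ringOfSetsType mu).
  by move=> s; lra.
have [phi tphi he] := dense _ e0; exists phi => //.
have Lphi := L2_test tphi.
have hge' : {ae mu, forall s, (h \- phi) s = (g \- phi) s}.
  move: hge; apply: filterS; first exact: (ae_filter_ringOfSetsType mu).
  by move=> s /= ->.
by rewrite (ip_ae_eq (f' := g \- phi) (g' := g \- phi))//; exact: L2B.
Qed.

End RieszRepresentation.

(** * Functions of bounded Dirichlet energy *)

Section Energy.
Context {R : realType}.
Implicit Types (u v w f g h phi psi : R -> R) (a b c x s t z : R).
Notation mu := (@lebesgue_measure R).

Lemma Rintegral_shift f z M : continuous f -> 0 <= M ->
  (forall s, ~ `[- M, M]%classic s -> f s = 0) ->
  \int[mu]_s f (s + z) = \int[mu]_s f s.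
Proof.
move=> cf M0 f0; have [F dF] := antiderivative cf.
have dFz x : is_derive x 1 (fun s => F (s + z)) (f (x + z)).
  exact: is_derive_translate.
have cfz : continuous (fun s => f (s + z)) by exact: continuous_translate.
have zz : - `|z| <= z <= `|z| by rewrite -ler_norml.
have out N s : M + `|z| <= N -> ~ `[- N, N]%classic s -> f (s + z) = 0.
  move=> MN; rewrite /= in_itv/= => /negP h; apply: f0.
  rewrite /= in_itv/= => h'; move: h; move/andP: zz => [z1 z2]; move/andP: h' => [h1 h2].
  by rewrite negb_and -!ltNge => /orP[]; lra.
pose N := M + `|z|.
have NN : - N <= N by rewrite /N; have := normr_ge0 z; lra.
rewrite -(@Rintegral_restrict _ `[- N, N]%classic); last by move=> s; exact: out.
rewrite (Rintegral_derive dFz)//.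
have zNN : z - N <= z + N by lra.
rewrite -(@Rintegral_restrict _ `[z - N, z + N]%classic f); last first.
  move=> s h; apply: f0; move: h; rewrite /= !in_itv/= => /negP h.
  move=> h'; move: h; move/andP: zz => [z1 z2]; move/andP: h' => [h1 h2].
  by rewrite negb_and -!ltNge /N => /orP[]; lra.
by rewrite (Rintegral_derive dF)//; congr (F _ - F _); ring.
Qed.

(** The Dirichlet energy of u is at most C, in the dual form that survives
    translations and locally uniform limits without reference to a derivative. *)
Definition energy_le (C : R) u := continuous u /\ forall phi, test_function phi ->
  (\int[mu]_s (u s * derive1 phi s)) ^+ 2 <= C * ip phi phi.

Lemma distr_derivP u : (exists g, is_distr_deriv u g) ->
  is_distr_deriv u (distr_deriv u).
Proof. exact: xgetPex. Qed.

Lemma distr_deriv_unique u f g : is_distr_deriv u f -> is_distr_deriv u g ->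
  {ae mu, forall s, f s = g s}.
Proof.
move=> [lf hf] [lg hg].
have orth phi : test_function phi -> \int[mu]_s ((f \- g) s * phi s) = 0.
  move=> tphi.
  have := Rintegral_lin 1 (- 1) (integrable_locally_test lf tphi)
    (integrable_locally_test lg tphi).
  have -> : (fun s => 1 * (f s * phi s) + - 1 * (g s * phi s)) =
    (fun s => (f \- g) s * phi s) by apply/funext => s /=; ring.
  move=> ->; have := hf _ tphi; rewrite hg// => /oppr_inj ->.
  by rewrite mul1r mulN1r subrr.
have := du_bois_reymond (locally_integrableB lf lg) orth.
apply: filterS; first exact: (ae_filter_ringOfSetsType mu).
by move=> s /= /eqP; rewrite subr_eq0 => /eqP.
Qed.

(** The bound says that phi |-> - int u phi' is continuous for the L^2 norm, so
    it is represented by a square-integrable function, which is the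
    distributional derivative of u. *)
Lemma energy_H1dot C u : 0 <= C -> energy_le C u ->
  [/\ H1dot u, is_distr_deriv u (distr_deriv u), L2 (distr_deriv u) &
      ip (distr_deriv u) (distr_deriv u) <= C].
Proof.
move=> C0 [cu hu].
pose ell phi := - \int[mu]_s (u s * derive1 phi s).
have [||g [Lg hg gC _]] := @riesz_test _ ell C C0.
- move=> a b phi psi tphi tpsi; rewrite /ell.
  have iphi := integrableR_continuous_test cu (test_derive1 tphi).
  have ipsi := integrableR_continuous_test cu (test_derive1 tpsi).
  have := Rintegral_lin a b iphi ipsi.
  have d s : is_derive s 1 (fun s => a * phi s + b * psi s) (a * derive1 phi s + b * derive1 psi s).
    by apply: is_derive_lin; apply: smooth_is_derive1; exact: test_smooth.
  rewrite (is_derive1_derive1 d).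
  have -> : (fun s => a * (u s * derive1 phi s) + b * (u s * derive1 psi s)) =
    (fun s => u s * (a * derive1 phi s + b * derive1 psi s)).
    by apply/funext => s; ring.
  by move=> ->; rewrite opprD !mulrN.
- by move=> phi tphi; rewrite /ell sqrrN; exact: hu.
have ug : is_distr_deriv u g.
  split; first exact: L2_locally_integrable.
  by move=> phi tphi; have := hg _ tphi; rewrite /ell /ip => ->; rewrite opprK.
have ud := distr_derivP (ex_intro _ g ug).
have dg := distr_deriv_unique ud ug.
have md : measurableR (distr_deriv u) by case: ud => -[].
have Ld := L2_ae_eq md Lg dg.
split => //; first by split => //; exists g.
by rewrite (ip_ae_eq (f' := g) (g' := g)).
Qed.

Lemma dirichlet_energy C u : continuous u -> (dirichlet u <= C%:E)%E -> energy_le C u.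
Proof.
move=> cu; rewrite /dirichlet; case: asboolP => [ex|_]; last by rewrite leye_eq.
move=> hC; have ud := distr_derivP ex; have [[md _ _] hd] := ud.
have md2 : measurableR (fun s => distr_deriv u s ^+ 2) by exact: measurable_funX.
have i2 : integrableR (fun s => distr_deriv u s ^+ 2).
  apply/integrableP; split; first exact: (measurable_EFinP _ (fun s => distr_deriv u s ^+ 2)).2.
  apply: le_lt_trans (ltry C); apply: le_trans hC.
  rewrite le_eqVlt; apply/orP; left; apply/eqP/eq_integral => s _ /=.
  by rewrite normrX.
have Ld : L2 (distr_deriv u) by exact/L2P.
have dC : ip (distr_deriv u) (distr_deriv u) <= C.
  rewrite -lee_fin -Rintegral_EFin; last exact: L2_sqr.
  apply: le_trans hC; rewrite le_eqVlt; apply/orP; left; apply/eqP/eq_integral => s _ /=.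
  by rewrite -normrX ger0_norm ?sqr_ge0// expr2.
split=> // phi tphi; have Lphi := L2_test tphi.
rewrite hd// sqrrN; apply: le_trans (cauchy_schwarz Ld Lphi) _.
by rewrite ler_wpM2r// ip_ge0.
Qed.

Lemma energy_shift C u z : energy_le C u -> energy_le C (fun s => u (s + z)).
Proof.
move=> [cu hu]; split; first exact: continuous_translate.
move=> phi tphi; have tpsi := test_shift (- z) tphi.
have [M M0 hM] := test_support tpsi.
have [N N0 hN] := test_support (test_derive1 tpsi).
have cpsi := test_continuous tpsi.
have cpsi' := test_continuous (test_derive1 tpsi).
have d x : is_derive x 1 (fun s => phi (s - z)) (derive1 phi (x - z)).
  exact/is_derive_translate/smooth_is_derive1/test_smooth.
have := hu _ tpsi; rewrite (is_derive1_derive1 d) in hN cpsi' *.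
rewrite /ip -(@Rintegral_shift (fun s => u s * derive1 phi (s - z)) z N)//; last 2 first.
- by move=> s; apply: cvgM; [exact: cu|exact: cpsi'].
- by move=> s /hN ->; rewrite mulr0.
rewrite -(@Rintegral_shift (fun s => phi (s - z) * phi (s - z)) z M)//; last 2 first.
- by move=> s; apply: cvgM; exact: cpsi.
- by move=> s /hM ->; rewrite mulr0.
by under eq_Rintegral do rewrite addrK; under [X in _ <= _ * X]eq_Rintegral do rewrite addrK.
Qed.

Lemma norm_le_sqr x c : 0 <= c -> x ^+ 2 <= c ^+ 2 -> `|x| <= c.
Proof.
move=> c0; rewrite -(real_normK (num_real x)) => h.
by rewrite leNgt; apply/negP => cx; have := normr_ge0 x; nra.
Qed.

Lemma ler_norm_quarters (p q x y e : R) : `|x - y| <= e / 4 -> `|p| <= e / 4 ->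
  `|q| <= e / 4 -> `|p + - x - (q + - y)| <= e.
Proof.
rewrite !ler_norml => /andP[? ?] /andP[? ?] /andP[? ?].
by apply/andP; split; lra.
Qed.

(** Locally uniform convergence in quantitative form: uniform on each bounded
    interval. *)
Definition cvg_loc (v : nat -> R -> R) w := forall M e : R, 0 < e ->
  exists N, forall k s, (N <= k)%N -> `|s| <= M -> `|v k s - w s| <= e.

Lemma cvg_loc_continuous (v : nat -> R -> R) w : (forall k, continuous (v k)) ->
  cvg_loc v w -> continuous w.
Proof.
move=> cv vw x; apply/cvgrPdist_le => e e0.
have e3 : 0 < e / 3 by rewrite divr_gt0.
have [N hN] := vw (`|x| + 1) _ e3.
have := cv N x => /cvgrPdist_le/(_ _ e3) => hx.
near=> y.
have h1 : `|v N x - v N y| <= e / 3 by near: y.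
have h2 : `|v N x - w x| <= e / 3 by apply: hN => //; rewrite lerDl.
have h3 : `|v N y - w y| <= e / 3.
  apply: hN => //; have -> : y = x - (x - y) by ring.
  apply: le_trans (ler_normB _ _) _; rewrite lerD2l; near: y.
  by apply: (@cvgr_dist_le _ _ _ _ _ id) => //.
move: h1 h2 h3; rewrite !ler_norml => /andP[? ?] /andP[? ?] /andP[? ?].
by apply/andP; split; lra.
Unshelve. all: by end_near. Qed.

Lemma cvg_loc_test (v : nat -> R -> R) w psi : (forall k, continuous (v k)) ->
  cvg_loc v w -> test_function psi ->
  \int[mu]_s (v k s * psi s) @[k --> \oo] --> \int[mu]_s (w s * psi s).
Proof.
move=> cv vw tpsi; have cw := cvg_loc_continuous cv vw.
have [M M0 hM] := test_support tpsi; have cpsi := test_continuous tpsi.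
have iabs : integrableR (fun s => `|psi s|).
  apply: (@integrableR_continuous _ _ (- M) M).
    by move=> s; apply: cvg_norm; exact: cpsi.
  by move=> s /hM ->; rewrite normr0.
pose A := \int[mu]_s `|psi s|.
have A0 : 0 <= A by apply: Rintegral_ge0.
apply/cvgrPdist_le => e e0.
have eA : 0 < e / (A + 1) by rewrite divr_gt0//; lra.
have [N hN] := vw M _ eA; exists N => // k /= Nk.
have iw := integrableR_continuous_test cw tpsi.
have iv := integrableR_continuous_test (cv k) tpsi.
have := Rintegral_lin 1 (- 1) iw iv; rewrite mul1r mulN1r => <-.
apply: le_trans (le_normr_Rintegral measurableT (integrableR_lin 1 (- 1) iw iv)) _.
apply: le_trans (_ : _ <= \int[mu]_s (e / (A + 1) * `|psi s|)) _.
  apply: le_Rintegral => //.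
  - by have := integrable_norm (integrableR_lin 1 (- 1) iw iv).
  - by have := integrableZl measurableT (e / (A + 1)) iabs; exact: eq_integrable.
  - move=> s _; rewrite mul1r mulN1r -mulrBl normrM.
    have [sM|/hM ->] := pselect (`[- M, M]%classic s); last by rewrite normr0 !mulr0.
    rewrite ler_wpM2r// distrC; apply: hN => //.
    by move: sM; rewrite /= in_itv/= ler_norml.
rewrite RintegralZl// -/A mulrAC ler_pdivrMr; last lra.
by rewrite ler_wpM2l// ?ltW//; lra.
Qed.

Lemma energy_limit C (v : nat -> R -> R) w : (forall k, energy_le C (v k)) ->
  cvg_loc v w -> energy_le C w.
Proof.
move=> vC vw; have cv k : continuous (v k) by case: (vC k).
split; first exact: cvg_loc_continuous vw.
move=> phi tphi; have h := cvg_loc_test cv vw (test_derive1 tphi).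
have h2 : (\int[mu]_s (v k s * derive1 phi s)) ^+ 2 @[k --> \oo] -->
    (\int[mu]_s (w s * derive1 phi s)) ^+ 2.
  by rewrite expr2; under eq_fun do rewrite expr2; exact: cvgM.
rewrite -(cvg_lim _ h2)//; apply: limr_le; first by apply/cvg_ex; eexists; exact: h2.
by apply: nearW => k; have [_] := vC k; apply.
Qed.

(** Against a test function, weak convergence of the derivatives is locally
    uniform convergence of the functions after an integration by parts; the
    energy bound and the density of test functions extend it to L^2. *)
Lemma energy_weak_cvg C (v : nat -> R -> R) w : 0 <= C ->
  (forall k, energy_le C (v k)) -> cvg_loc v w -> weak_cvg_H1dot v w.
Proof.
move=> C0 vC vw; have cv k : continuous (v k) by case: (vC k).
have [Hw dw Lw wC] := energy_H1dot C0 (energy_limit vC vw).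
have Hv k := energy_H1dot C0 (vC k).
split=> [k| |]; [by case: (Hv k)|exact: Hw|].
split=> [k| |h Lh]; [by case: (Hv k)|exact: Lw|].
apply/cvgrPdist_le => e e0.
pose d := (e / 4) ^+ 2 / (C + 1).
have d0 : 0 < d by rewrite divr_gt0 ?exprn_gt0 ?divr_gt0//; lra.
have [phi tphi hphi] := test_dense Lh d0.
have Lphi := L2_test tphi.
have Lhphi := L2B Lh Lphi.
have small g : L2 g -> ip g g <= C -> `|ip g (h \- phi)| <= e / 4.
  move=> Lg gC; apply: norm_le_sqr; first by rewrite divr_ge0// ltW.
  apply: le_trans (cauchy_schwarz Lg Lhphi) _.
  apply: le_trans (_ : _ <= (C + 1) * d) _; last first.
    by rewrite /d mulrC divfK// gt_eqF// ltr_wpDl.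
  have gC1 : ip g g <= C + 1 by apply: le_trans gC _; rewrite lerDl.
  exact: ler_pM (ip_ge0 _) (ip_ge0 _) gC1 hphi.
have split_ip g : L2 g -> ip g h = ip g (h \- phi) + ip g phi.
  move=> Lg; have := ip_linr 1 1 Lhphi Lphi Lg; rewrite !mul1r => <-.
  by congr ip; apply/funext => s /=; ring.
have test_eq u : is_distr_deriv u (distr_deriv u) ->
    ip (distr_deriv u) phi = - \int[mu]_s (u s * derive1 phi s).
  by move=> [_ hu]; rewrite hu// opprK.
have := cvg_loc_test cv vw (test_derive1 tphi).
have e4 : 0 < e / 4 by rewrite divr_gt0.
move=> /cvgrPdist_le/(_ _ e4); apply: filterS => k hk.
have [_ dv Lv vkC] := Hv k.
rewrite -/(ip _ _) -/(ip (distr_deriv (v k)) h) !split_ip// !test_eq//.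
exact: ler_norm_quarters hk (small _ Lw wC) (small _ Lv vkC).
Qed.

(** The Cauchy-Schwarz inequality for g and the indicator of [a, b]. With A the
    whole line it yields the Hoelder bound; with A far from the origin, it says
    that u is almost constant there. *)
Lemma energy_increment u g (A : set (measurableTypeR R)) a b : continuous u ->
  is_distr_deriv u g -> L2 g -> measurable A -> a <= b -> `[a, b] `<=` A ->
  (u b - u a) ^+ 2 <= (b - a) * \int[mu]_(s in A) (g s ^+ 2).
Proof.
move=> cu ug Lg mA ab abA.
have LA : L2 (fun s => g s * \1_A s).
  have [mg g2] := (L2P g).1 Lg.
  have mgA : measurableR (fun s => g s * \1_A s).
    by apply: measurable_funM => //; exact: measurable_indic.
  apply/L2P; split => //; apply: le_integrableR g2 _.
    exact: measurable_funX.
  move=> s; rewrite indicE; case: (_ \in _); rewrite ?mulr1 ?mulr0.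
    by rewrite ger0_norm ?sqr_ge0.
  by rewrite expr0n/= normr0 sqr_ge0.
pose chi : R -> R := \1_(`[a, b]%classic : set (measurableTypeR R)).
have mchi : measurableR chi by exact: measurable_indic.
have chi2 s : chi s ^+ 2 = chi s.
  by rewrite /chi indicE; case: (_ \in _); rewrite ?expr1n ?expr0n.
have ichi : integrableR chi by exact: integrable_indic_itv.
have Lchi : L2 chi.
  by apply/L2P; split => //; apply: eq_integrable ichi => // s _ /=; rewrite chi2.
have chiE : ip chi chi = b - a.
  rewrite /ip; under eq_Rintegral do rewrite -expr2 chi2.
  rewrite /Rintegral integral_indic// setIT.
  have muE : fine (mu `[a, b]%classic) = b - a.
    rewrite lebesgue_measure_itv/= lte_fin; case: ltP => // ba.
    by apply/eqP; rewrite eq_sym subr_eq0 eq_le ab ba.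
  exact: muE.
have gE : ip chi (fun s => g s * \1_A s) = u b - u a.
  rewrite -(distr_deriv_FTC cu ug ab) [RHS]Rintegral_mkcond.
  apply: eq_Rintegral => s _; rewrite patchE /chi indicE.
  case: ifPn => sab; rewrite ?mul0r// mul1r indicE mem_set ?mulr1//.
  by apply: abA; rewrite inE in sab.
have AE : ip (fun s => g s * \1_A s) (fun s => g s * \1_A s) = \int[mu]_(s in A) (g s ^+ 2).
  rewrite [RHS]Rintegral_mkcond; apply: eq_Rintegral => s _; rewrite patchE indicE.
  by case: (_ \in _); rewrite ?mulr1 ?mulr0// expr2.
by have := cauchy_schwarz Lchi LA; rewrite chiE gE AE.
Qed.

Lemma energy_hoelder C u a b : 0 <= C -> energy_le C u -> a <= b ->
  (u b - u a) ^+ 2 <= C * (b - a).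
Proof.
move=> C0 uC ab; have [_ ud Ld dC] := energy_H1dot C0 uC.
have := energy_increment uC.1 ud Ld measurableT ab (@subsetT _ _).
by move=> /le_trans; apply; rewrite mulrC ler_wpM2r ?subr_ge0.
Qed.

Lemma measurable_norm_ge c : measurable ([set s | c <= `|s|] : set (measurableTypeR R)).
Proof.
apply: closed_measurable.
by apply: (closed_comp (f := @Num.norm _ R) (D := [set z | c <= z])) => [y _|];
  [exact: norm_continuous|exact: closed_ge].
Qed.

Lemma L2_tail g e : L2 g -> 0 < e ->
  exists2 N, 0 <= N & \int[mu]_(s in [set s | N <= `|s|]) (g s ^+ 2) <= e.
Proof.
move=> Lg e0; have [mg g2] := (L2P g).1 Lg.
pose A n : set (measurableTypeR R) := [set s | n%:R <= `|s|].
have mA n : measurable (A n) by exact: measurable_norm_ge.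
have : \int[mu]_s (g s ^+ 2 * \1_(A n) s) @[n --> \oo] --> \int[mu]_s (cst (0 : R) s).
  apply: (@Rintegral_dominated _ _ _ (fun s => g s ^+ 2)) => //.
  - move=> n; apply: measurable_funM; first exact: measurable_funX.
    exact: measurable_indic.
  - move=> s; apply: cvg_near_cst; near=> n.
    have sn : `|s| < n%:R by near: n; exact: nbhs_infty_gtr.
    have sA : ~ A n s by rewrite /A/= leNgt sn.
    by rewrite indicE memNset// mulr0.
  - move=> n s; rewrite indicE; case: (_ \in _); rewrite ?mulr1 ?mulr0.
      by rewrite ger0_norm ?sqr_ge0.
    by rewrite normr0 sqr_ge0.
rewrite Rintegral_cst// mul0r => /cvgrPdist_le/(_ _ e0)[n _ /(_ n (leqnn n))] /=.
rewrite sub0r normrN => h; exists n%:R => //; apply: le_trans h.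
apply: le_trans (ler_norm _); rewrite le_eqVlt; apply/orP; left; apply/eqP.
rewrite Rintegral_mkcond; apply: eq_Rintegral => s _; rewrite patchE indicE.
by rewrite /A; case: (_ \in _); rewrite ?mulr1 ?mulr0.
Unshelve. all: by end_near. Qed.

End Energy.

(** * Compactness *)

Section Compactness.
Context {R : realType}.
Implicit Types (u w U W : R -> R) (a b x s t : R).

Lemma extract_increasing (P : nat -> nat -> Prop) :
  (forall n N, exists2 k, (N <= k)%N & P n k) ->
  exists2 sigma : nat -> nat, increasing_seq sigma & forall n, P n (sigma n).
Proof.
move=> h; have /choice[f hf] : forall p : nat * nat, exists k, (p.2 <= k)%N /\ P p.1 k.
  by move=> [n N]; have [k Nk Pk] := h n N; exists k.
pose fix sigma n := if n is m.+1 then f (m.+1, (sigma m).+1) else f (0, 0)%N.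
exists sigma.
  by apply/increasing_seqP => n; have [] := hf (n.+1, (sigma n).+1).
by case=> [|n]; [have [] := hf (0, 0)%N|have [] := hf (n.+1, (sigma n).+1)].
Qed.

Import ArrowAsProduct.

(** By Tychonoff's theorem a pointwise bounded sequence has a cluster point in
    the product topology, whose neighbourhoods control finitely many points. *)
Lemma pointwise_cluster (v : nat -> R -> R) (B : R -> R) :
  (forall k s, `|v k s| <= B s) ->
  exists w : R -> R, forall (q : nat -> R) (m N : nat) (d : R), 0 < d ->
    exists2 k, (N <= k)%N & forall i, (i < m)%N -> `|v k (q i) - w (q i)| < d.
Proof.
move=> vB.
have cK : compact [set f : R -> R | forall s, `[- B s, B s]%classic (f s)].
  exact: (@tychonoff R (fun=> R) (fun s => `[- B s, B s]%classic)
    (fun s => @segment_compact _ _ _)).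
have [|w [_ cw]] := cK (v @ \oo) _.
  by exists 0%N => // k _ s; rewrite /= in_itv/= -ler_norml.
exists w => q m N d d0.
have nb : nbhs w [set f : R -> R | forall i, (i < m)%N -> `|f (q i) - w (q i)| < d].
  elim: m => [|m IH]; first by apply: filterS filterT => f _ i.
  have nm : nbhs w [set f : R -> R | `|f (q m) - w (q m)| < d].
    have := @proj_continuous R (fun=> R) (q m) w.
    move=> /cvgrPdist_lt/(_ _ d0); apply: filterS => f /=.
    by rewrite distrC.
  apply: filterS2 IH nm => f h1 h2 i; rewrite ltnS leq_eqVlt => /orP[/eqP -> //|].
  exact: h1.
have FN : (v @ \oo) [set f | exists2 k, (N <= k)%N & f = v k].
  by exists N => // k /= Nk; exists k.
have [f [[k Nk ->] hk]] := cw _ _ FN nb.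
by exists k.
Qed.

Lemma nat_floor (x : R) : 0 <= x -> exists n : nat, n%:R <= x < n.+1%:R.
Proof. by move=> /truncn_itv; exists (Num.truncn x). Qed.

(** Sequential Arzela-Ascoli: a cluster point for pointwise convergence is
    approached on finer and finer finite grids, and the common modulus of
    continuity fills the gaps between grid points. *)
Lemma hoelder_compactness (C : R) (v : nat -> R -> R) : 0 <= C ->
  (forall k, v k 0 = 0) ->
  (forall k a b, a <= b -> (v k b - v k a) ^+ 2 <= C * (b - a)) ->
  exists w, exists2 sigma : nat -> nat, increasing_seq sigma &
    cvg_loc (fun j => v (sigma j)) w.
Proof.
move=> C0 v0 vC.
have [w hw] : exists w : R -> R, forall (q : nat -> R) (m N : nat) (d : R), 0 < d ->
    exists2 k, (N <= k)%N & forall i, (i < m)%N -> `|v k (q i) - w (q i)| < d.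
  apply: (@pointwise_cluster _ (fun s => 1 + C * `|s|)) => k s.
  have Cs0 : 0 <= C * `|s| by rewrite mulr_ge0.
  apply: norm_le_sqr; first by rewrite addr_ge0.
  apply: le_trans (_ : _ <= C * `|s|) _; last by nra.
  have [s0|s0] := leP 0 s.
    by have := vC k 0 s s0; rewrite v0 !subr0 ger0_norm.
  by have := vC k s 0 (ltW s0); rewrite v0 !sub0r sqrrN ltr0_norm.
have wC a b : a <= b -> (w b - w a) ^+ 2 <= C * (b - a).
  move=> ab; have c0 : 0 <= C * (b - a) by rewrite mulr_ge0 ?subr_ge0.
  suff h : `|w b - w a| <= Num.sqrt (C * (b - a)).
    by rewrite -(real_normK (num_real (w b - w a))) -[leRHS]sqr_sqrtr// lerXn2r ?nnegrE.
  apply/ler_addgt0Pr => e e0; have e2 : 0 < e / 2 by rewrite divr_gt0.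
  have [k _ hk] := hw (fun i => if i == 0%N then a else b) 2%N 0%N _ e2.
  have ha := hk 0%N isT; have hb := hk 1%N isT; rewrite /= in ha hb.
  have h : `|v k b - v k a| <= Num.sqrt (C * (b - a)).
    by apply: norm_le_sqr; rewrite ?sqrtr_ge0// sqr_sqrtr// vC.
  have -> : w b - w a = (v k b - v k a) - ((v k b - w b) - (v k a - w a)) by ring.
  apply: le_trans (ler_normB _ _) _; apply: lerD => //.
  apply: le_trans (ler_normB _ _) _; lra.
pose P n k := forall s, `|s| <= n%:R -> exists q : R, [/\ q <= s, s - q <= n.+1%:R^-1 &
  `|v k q - w q| <= n.+1%:R^-1].
have [n N|sigma sinc sP] := @extract_increasing P.
  have n0 : 0 < n.+1%:R :> R by rewrite ltr0n.
  have in0 : 0 < n.+1%:R^-1 :> R by rewrite invr_gt0.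
  (* The grid of mesh 1 / (n + 1) that covers [- n, n]. *)
  pose q i : R := i%:R / n.+1%:R - n%:R.
  have [k Nk hk] := hw q (n * 2 * n.+1).+1 N _ in0.
  exists k => // s; rewrite ler_norml => /andP[s1 s2].
  have x0 : 0 <= (s + n%:R) * n.+1%:R by rewrite mulr_ge0//; lra.
  have [i /andP[i1 i2]] := nat_floor x0.
  exists (q i); split.
  - by rewrite /q lerBlDr ler_pdivrMr.
  - rewrite /q opprB addrA lerBlDr -{1}[_^-1]mul1r -mulrDl ler_pdivlMr//.
    by rewrite [1 + _]addrC natr1 ltW.
  - apply/ltW/hk; rewrite ltnS -(ler_nat R) !natrM.
    apply: le_trans i1 _; rewrite ler_wpM2r ?ler0n//; lra.
exists w, sigma => // M e e0.
have e3 : 0 < e / 3 by rewrite divr_gt0.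
have C1 : 0 < C + 1 by lra.
have d0 : 0 < (e / 3) ^+ 2 / (C + 1) by rewrite divr_gt0// exprn_gt0.
have [N1 _ hN1] := near_infty_natSinv_lt (PosNum d0).
have [N2 _ hN2] := near_infty_natSinv_lt (PosNum e3).
have [N3 _ hN3] := nbhs_infty_ger M.
exists (maxn N1 (maxn N2 N3)) => n s; rewrite !geq_max => /and3P[n1 n2 n3] sM.
have := hN1 n n1; have := hN2 n n2; have := hN3 n n3; rewrite /= => Mn h2 h1.
have [q [qs qn vq]] := sP n s (le_trans sM Mn).
have small f : (forall a b, a <= b -> (f b - f a) ^+ 2 <= C * (b - a)) ->
    `|f s - f q| <= e / 3.
  move=> fC; apply: norm_le_sqr; first exact: ltW.
  apply: le_trans (fC _ _ qs) _.
  apply: le_trans (_ : _ <= (C + 1) * ((e / 3) ^+ 2 / (C + 1))) _; last first.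
    by rewrite mulrC divfK// gt_eqF.
  apply: ler_pM => //; first by rewrite subr_ge0.
    by rewrite lerDl.
  exact: le_trans qn (ltW h1).
have a1 := small _ (vC (sigma n)); have a2 := small _ wC.
have a3 : `|v (sigma n) q - w q| <= e / 3 by apply: le_trans vq (ltW h2).
move: a1 a2 a3; rewrite !ler_norml => /andP[? ?] /andP[? ?] /andP[? ?].
by apply/andP; split; lra.
Qed.

End Compactness.

(** * Selection of the zeros *)

Section ZeroSelection.
Context {R : realType}.
Implicit Types (u w U W : R -> R) (a b x s t z : R).
Notation mu := (@lebesgue_measure R).

Lemma le_of_derive_ge0 U u a b : (forall x, is_derive x 1 U (u x)) -> a <= b ->
  (forall x, a <= x -> x <= b -> 0 <= u x) -> U a <= U b.
Proof.
move=> dU ab u0; have [c [ac cb]] := mean_value dU ab.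
by rewrite -subr_ge0 => ->; rewrite mulr_ge0 ?subr_ge0// u0.
Qed.

Lemma le_of_derive_le U u a b m : (forall x, is_derive x 1 U (u x)) -> a <= b ->
  (forall x, a <= x -> x <= b -> u x <= m) -> U b <= U a + m * (b - a).
Proof.
move=> dU ab u0; have [c [ac cb]] := mean_value dU ab.
move=> /eqP; rewrite subr_eq => /eqP ->; rewrite addrC lerD2l ler_wpM2r ?subr_ge0//.
exact: u0.
Qed.

(** The primitive decreases near -oo and increases near +oo, so its minimum over
    a large interval is global, and its derivative vanishes there. *)
Lemma zero_at_minimum u : continuous u ->
  (exists A, forall s, s < A -> u s < 0) -> (exists B, forall s, B < s -> 0 < u s) ->
  exists z, u z = 0 /\ exists2 U : R -> R,
    (forall x, is_derive x 1 U (u x)) & forall s, U z <= U s.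
Proof.
move=> cu [A uA] [B uB]; have [U dU] := antiderivative cu.
pose M := `|A| + `|B| + 1.
have AM : - M < A by rewrite /M; have := ler_norm (- A); rewrite normrN; have := normr_ge0 B; lra.
have BM : B < M by rewrite /M; have := ler_norm B; have := normr_ge0 A; lra.
have MM : - M <= M by rewrite /M; have := normr_ge0 A; have := normr_ge0 B; lra.
have [z zM hz] := EVT_min MM (continuous_subspaceT (is_derive_continuous dU)).
have Uz s : U z <= U s.
  have [sM|sM] := ltP s (- M).
    apply: le_trans (_ : _ <= U (- M)) _.
      by apply: hz; rewrite in_itv/= lexx.
    have := @le_of_derive_le U u s (- M) 0 dU (ltW sM).
    rewrite mul0r addr0; apply => x _ xM; apply: ltW; apply: uA.
    exact: le_lt_trans AM.
  have [Ms|Ms] := ltP M s.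
    apply: le_trans (_ : _ <= U M) _.
      by apply: hz; rewrite in_itv/= lexx andbT.
    apply: (le_of_derive_ge0 dU (ltW Ms)) => x Mx _; apply: ltW; apply: uB.
    exact: lt_le_trans BM _.
  by apply: hz; rewrite in_itv/= sM Ms.
exists z; split; last by exists U.
have : is_derive z 1 U 0.
  apply: (@derive1_at_min _ _ (z - 1) (z + 1)).
  - by lra.
  - by move=> t _; case: (dU t).
  - by rewrite in_itv/= ltrBlDr ltrDl ltr01.
  - by move=> t _; exact: Uz.
by have dz := dU z => dz0; rewrite -(@derive_val _ _ _ _ _ _ _ dz) (@derive_val _ _ _ _ _ _ _ dz0).
Qed.

(** Minimality survives the limit because the primitives, up to constants,
    converge locally uniformly as well. *)
Lemma minimum_limit (v V : nat -> R -> R) w W :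
  (forall k x, is_derive x 1 (V k) (v k x)) -> (forall k s, V k 0 <= V k s) ->
  cvg_loc v w -> (forall x, is_derive x 1 W (w x)) -> forall s, W 0 <= W s.
Proof.
move=> dV Vmin vw dW s.
apply/ler_addgt0Pr => e e0.
have s1 : 0 < `|s| + 1 by rewrite ltr_wpDl.
have [N hN] := vw `|s| _ (divr_gt0 e0 s1).
have dD x : is_derive x 1 (fun x => 1 * W x + - 1 * V N x) (1 * w x + - 1 * v N x).
  exact: is_derive_lin.
have wv c : `|c| <= `|s| -> `|1 * w c + - 1 * v N c| * `|s| <= e.
  move=> cs; rewrite mul1r mulN1r distrC.
  apply: le_trans (_ : _ <= e / (`|s| + 1) * (`|s| + 1)) _.
    by apply: ler_pM => //; [exact: hN|rewrite lerDl].
  by rewrite divfK// gt_eqF.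
have key : `|(1 * W s + - 1 * V N s) - (1 * W 0 + - 1 * V N 0)| <= e.
  have [s0|/ltW s0] := leP 0 s.
    have [c [c0 cs ->]] := mean_value dD s0.
    by rewrite subr0 normrM wv// !ger0_norm.
  have [c [cs c0 h]] := mean_value dD s0.
  rewrite distrC h normrM sub0r normrN wv// !ler0_norm//.
  by rewrite lerN2.
by move: key; rewrite ler_norml => /andP[h _]; have := Vmin N s; lra.
Qed.

(** Were w eventually nonpositive, its primitive would decrease by a fixed amount
    at each return of w below a fixed negative level, against the bound W 0. *)
Lemma sign_changes_pinfty (C : R) w W : 0 <= C ->
  (forall a b, a <= b -> (w b - w a) ^+ 2 <= C * (b - a)) ->
  (forall x, is_derive x 1 W (w x)) -> (forall s, W 0 <= W s) ->
  ~ (forall d, 0 < d -> exists A, forall s, A < s -> - d <= w s) ->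
  forall n : R, exists a b, [/\ n <= a, n <= b, w a < 0 & 0 < w b].
Proof.
move=> C0 wC dW Wmin bad n.
have [d d0 hd] : exists2 d, 0 < d & forall A, exists2 s, A < s & w s < - d.
  apply: contrapT => h; apply: bad => d d0; apply: contrapT => hA; apply: h.
  exists d => // A; apply: contrapT => hs; apply: hA; exists A => s As.
  by rewrite leNgt; apply/negP => ws; apply: hs; exists s.
have [a na wa] := hd n; exists a.
suff [b nb wb] : exists2 b, n <= b & 0 < w b.
  by exists b; split => //; [exact: ltW|lra].
apply: contrapT => neg.
have wneg x : n <= x -> w x <= 0.
  by move=> nx; rewrite leNgt; apply/negP => wx; apply: neg; exists x.
have C1 : 0 < C + 1 by lra.
(* After each return below - d the function stays below - d / 2 for a time r. *)
pose r := (d / 2) ^+ 2 / (C + 1).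
have d2 : 0 < d / 2 by rewrite divr_gt0.
have r0 : 0 < r by rewrite divr_gt0// exprn_gt0.
have stay t x : w t < - d -> t <= x -> x <= t + r -> w x <= - (d / 2).
  move=> wt tx xt; have : `|w x - w t| <= d / 2.
    apply: norm_le_sqr; first exact: ltW.
    apply: le_trans (wC _ _ tx) _.
    apply: le_trans (_ : _ <= (C + 1) * r) _; last first.
      by rewrite /r mulrC divfK// gt_eqF.
    by apply: ler_pM => //; [rewrite subr_ge0|rewrite lerDl|rewrite lerBlDl].
  by rewrite ler_norml => /andP[_ h]; lra.
have descend m : exists2 t, n <= t & W t <= W n - m%:R * (d / 2 * r).
  elim: m => [|m [t nt ht]]; first by exists n; rewrite // mul0r subr0.
  have [t' tt' wt'] := hd t; exists (t' + r); first lra.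
  have h1 := @le_of_derive_le W w t t' 0 dW (ltW tt').
  have h2 := @le_of_derive_le W w t' (t' + r) (- (d / 2)) dW.
  have h1' : W t' <= W t.
    by rewrite -[leRHS]addr0 -(mul0r (t' - t)) h1// => x tx _; apply: wneg; lra.
  have h2' : W (t' + r) <= W t' + - (d / 2) * (t' + r - t').
    by apply: h2; [rewrite lerDl ltW|move=> x; exact: stay].
  rewrite -natr1 mulrDl mul1r; apply: le_trans h2' _.
  have -> : - (d / 2) * (t' + r - t') = - (d / 2 * r) by ring.
  by lra.
have dr : 0 < d / 2 * r by rewrite mulr_gt0.
have [m hm] : exists m : nat, (W n - W 0) / (d / 2 * r) < m%:R.
  have x0 : 0 <= (W n - W 0) / (d / 2 * r) by apply: divr_ge0; [rewrite subr_ge0|exact: ltW].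
  by have [i /andP[_ hi]] := nat_floor x0; exists i.+1.
have [t _ ht] := descend m; have := Wmin t.
by move: hm; rewrite ltr_pdivrMr//; lra.
Qed.

(** Far out, w carries little energy and so is almost constant at any fixed
    scale. Each sign change of w forces a nearby zero of v k for large k, and
    around such a zero v k is uniformly small. *)
Lemma vanishing_limit (C : R) (v : nat -> R -> R) w : 0 <= C ->
  (forall k, energy_le C (v k)) -> cvg_loc v w ->
  (forall n : R, exists a b, [/\ a <= b, forall s, a <= s -> s <= b -> n <= `|s| &
     w a * w b < 0]) ->
  exists sigma : nat -> nat, exists y : nat -> R,
    [/\ increasing_seq sigma, forall j, v (sigma j) (y j) = 0 &
        cvg_loc (fun j s => v (sigma j) (s + y j)) (cst 0)].
Proof.
move=> C0 vC vw changes.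
have wE := energy_limit vC vw; have [cw _] := wE.
have [_ dw Lw _] := energy_H1dot C0 wE.
set g := distr_deriv w in dw Lw.
pose P (n k : nat) := exists2 y : R, v k y = 0 &
  forall s, `|s| <= n%:R -> `|v k (s + y)| <= 3 * n.+1%:R^-1.
have [n N|sigma sinc sP] := @extract_increasing P.
  have n1 : 0 < n.+1%:R :> R by rewrite ltr0n.
  have in1 : 0 < n.+1%:R^-1 :> R by rewrite invr_gt0.
  (* A tail energy of (n + 1)^-3 bounds increments over lengths at most n by
     (n + 1)^-1, thanks to the factor b - a in the increment estimate. *)
  have e0 : 0 < n.+1%:R^-1 ^+ 3 :> R by rewrite exprn_gt0.
  have [T T0 hT] := L2_tail Lw e0.
  have [a [b [ab far sgn]]] := changes (T + n%:R).
  have wa0 : w a != 0 by apply: contraTneq sgn => ->; rewrite mul0r ltxx.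
  have wb0 : w b != 0 by apply: contraTneq sgn => ->; rewrite mulr0 ltxx.
  (* An error of at most eta preserves the signs of w at a and at b. *)
  pose eta := Num.min n.+1%:R^-1 (Num.min (`|w a| / 2) (`|w b| / 2)).
  have eta0 : 0 < eta by rewrite !lt_min in1 !divr_gt0 ?normr_gt0.
  have etan : eta <= n.+1%:R^-1 by rewrite ge_min lexx.
  have etaa : eta <= `|w a| / 2 by rewrite !ge_min lexx orbT.
  have etab : eta <= `|w b| / 2 by rewrite !ge_min lexx !orbT.
  have [k0 hk0] := vw (`|a| + `|b| + n%:R) _ eta0.
  exists (maxn N k0); first exact: leq_maxl.
  set k := maxn N k0.
  have hk s : `|s| <= `|a| + `|b| + n%:R -> `|v k s - w s| <= eta.
    by apply: hk0; exact: leq_maxr.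
  have n0 : 0 <= n%:R :> R by [].
  have na := normr_ge0 a; have nb := normr_ge0 b.
  have va : `|v k a - w a| <= eta by apply: hk; lra.
  have vb : `|v k b - w b| <= eta by apply: hk; lra.
  have [y yab vy] : exists2 y, y \in `[a, b]%R & v k y = 0.
    apply: IVT => //; first by apply: continuous_subspaceT; case: (vC k).
    move: va vb etaa etab sgn; move: (v k a) (v k b) (w a) (w b) eta0 => p q x x' eta0.
    rewrite !ler_norml => /andP[p1 p2] /andP[q1 q2] xe x'e xx'.
    rewrite ge_min le_max.
    have [x0|x0|x0] := ltrgtP x 0; last by rewrite x0 mul0r ltxx in xx'.
      have x'0 : 0 < x' by rewrite -(nmulr_rlt0 _ x0).
      rewrite ltr0_norm// in xe; rewrite gtr0_norm// in x'e.
      by apply/andP; split; apply/orP; [left|right]; lra.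
    have x'0 : x' < 0 by rewrite -(pmulr_rlt0 _ x0).
    rewrite gtr0_norm// in xe; rewrite ltr0_norm// in x'e.
    by apply/andP; split; apply/orP; [right|left]; lra.
  move: yab; rewrite in_itv/= => /andP[ay yb].
  have ynorm : `|y| <= `|a| + `|b|.
    rewrite ler_norml; have := ler_norm b; have := ler_norm (- a); rewrite normrN.
    by move=> ? ?; apply/andP; split; lra.
  exists y => // s sn.
  have yT := far _ ay yb.
  have incr : `|w (s + y) - w y| <= n.+1%:R^-1.
    apply: norm_le_sqr; first exact: ltW.
    pose D : set (measurableTypeR R) := [set s | T <= `|s|].
    have mD : measurable D by exact: measurable_norm_ge.
    have inD x : `|x - y| <= n%:R -> D x.
      move=> xy; rewrite /D/=; have -> : x = y - (y - x) by ring.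
      by have := lerB_dist y (y - x); rewrite distrC in xy; lra.
    have bound x x' : x <= x' -> x' - x <= n%:R -> `[x, x'] `<=` D ->
        (w x' - w x) ^+ 2 <= n.+1%:R^-1 ^+ 2.
      move=> xx' xn xD; apply: le_trans (energy_increment cw dw Lw mD xx' xD) _.
      apply: le_trans (_ : _ <= n.+1%:R * n.+1%:R^-1 ^+ 3) _.
        apply: ler_pM => //; first by rewrite subr_ge0.
          by apply: Rintegral_ge0 => t _; exact: sqr_ge0.
        by apply: le_trans xn _; rewrite ler_nat.
      by rewrite exprS mulrA mulfV ?mul1r// gt_eqF.
    have [s0|/ltW s0] := leP 0 s.
      apply: bound; [lra|by move: sn; rewrite ger0_norm//; lra|].
      move=> x; rewrite /= in_itv/= => /andP[h1 h2]; apply: inD.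
      by move: sn; rewrite ger0_norm// ger0_norm; lra.
    rewrite -sqrrN opprB; apply: bound; [lra|by move: sn; rewrite ler0_norm//; lra|].
    move=> x; rewrite /= in_itv/= => /andP[h1 h2]; apply: inD.
    by move: sn; rewrite ler0_norm// ler0_norm; lra.
  have h1 : `|v k (s + y) - w (s + y)| <= n.+1%:R^-1.
    apply: le_trans etan; apply: hk; apply: le_trans (ler_normD _ _) _; lra.
  have h2 : `|v k y - w y| <= n.+1%:R^-1.
    by apply: le_trans etan; apply: hk; lra.
  rewrite vy sub0r normrN in h2.
  move: incr h1 h2; move: (n.+1%:R^-1) (w _) (w _) (v _ _) => c p q r.
  by rewrite !ler_norml => /andP[? ?] /andP[? ?] /andP[? ?]; apply/andP; split; lra.
have /choice[y hy] : forall j, exists y : R, v (sigma j) y = 0 /\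
    forall s, `|s| <= j%:R -> `|v (sigma j) (s + y)| <= 3 * j.+1%:R^-1.
  by move=> j; have [y ? ?] := sP j; exists y.
exists sigma, y; split => //; first by move=> j; case: (hy j).
move=> M e e0; have e3 : 0 < e / 3 by rewrite divr_gt0.
have [N1 _ hN1] := near_infty_natSinv_lt (PosNum e3).
have [N2 _ hN2] := nbhs_infty_ger M.
exists (maxn N1 N2) => j s; rewrite geq_max => /andP[j1 j2] sM.
have := hN1 j j1; have := hN2 j j2; rewrite /= => Mj h1.
rewrite subr0; apply: le_trans ((hy j).2 s (le_trans sM Mj)) _.
by rewrite mulrC -ler_pdivlMr// ltW.
Qed.

Lemma limsup_ninfty_lt0 u : (limsup_ninfty u < 0)%E ->
  exists A, forall s, s < A -> u s < 0.
Proof.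
rewrite /limsup_ninfty /limf_esup => /ereal_inf_lt[_ [V [A [_ hA]] <-] h].
exists A => s sA; rewrite -lte_fin; apply: le_lt_trans h.
by apply: ereal_sup_ubound; exists s => //; exact: hA.
Qed.

Lemma liminf_pinfty_gt0 u : (0 < liminf_pinfty u)%E ->
  exists B, forall s, B < s -> 0 < u s.
Proof.
rewrite /liminf_pinfty /limf_einf oppe_gt0 /limf_esup.
move=> /ereal_inf_lt[_ [V [B [_ hB]] <-] h].
exists B => s sB; rewrite -oppr_lt0 -lte_fin; apply: le_lt_trans h.
by apply: ereal_sup_ubound; exists s => //; exact: hB.
Qed.

Lemma limsup_ninfty_le0 u : (forall d, 0 < d -> exists A, forall s, s < A -> u s <= d) ->
  (limsup_ninfty u <= 0)%E.
Proof.
move=> h; apply/lee_addgt0Pr => d d0; rewrite add0e.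
have [A hA] := h _ d0.
apply: le_trans (_ : _ <= ereal_sup ((EFin \o u) @` [set s | (s < A)%R]))%E _.
  apply: ereal_inf_lbound; exists [set s | s < A] => //.
  by exists A; split => //; exact: num_real.
by apply: ge_ereal_sup => _ [s sA <-]; rewrite lee_fin; exact: hA.
Qed.

Lemma liminf_pinfty_ge0 u : (forall d, 0 < d -> exists A, forall s, A < s -> - d <= u s) ->
  (0 <= liminf_pinfty u)%E.
Proof.
move=> h; rewrite /liminf_pinfty /limf_einf oppe_ge0.
apply/lee_addgt0Pr => d d0; rewrite add0e.
have [A hA] := h _ d0.
apply: le_trans (_ : _ <= ereal_sup ((fun s => - (u s)%:E)%E @` [set s | (A < s)%R]))%E _.
  apply: ereal_inf_lbound; exists [set s | A < s] => //.
  by exists A; split => //; exact: num_real.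
by apply: ge_ereal_sup => _ [s sA <-]; rewrite lee_fin lerNl; exact: hA.
Qed.

Lemma cvg_loc_locally_uniform (v : nat -> R -> R) w : cvg_loc v w ->
  locally_uniform_cvg v w.
Proof.
move=> vw x; exists (ball x 1); first exact: nbhsx_ballx.
move=> Q /uniform_nbhs[E [entE EQ]].
move: entE; rewrite -entourage_ballE => -[e /= e0 he].
have e2 : 0 < e / 2 by rewrite divr_gt0.
have [N hN] := vw (`|x| + 1) _ e2; exists N => // k /= Nk.
apply: EQ => y /= xy; apply: he => /=; rewrite /ball/= distrC.
apply: le_lt_trans (hN k y Nk _) _; last by lra.
have -> : y = x - (x - y) by ring.
by apply: le_trans (ler_normB _ _) _; rewrite lerD2l ltW.
Qed.

End ZeroSelection.

(** * The energy bound along the sequence, and sign changes at either end *)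

Section Assembly.
Context {R : realType}.
Implicit Types (u w U W : R -> R) (a b x s t z : R).

Lemma energy_le_eventually (u_ : nat -> R -> R) : (forall k, continuous (u_ k)) ->
  (limn_esup (fun k => dirichlet (u_ k)) < +oo)%E ->
  exists C, 0 <= C /\ exists k0, forall k, (k0 <= k)%N -> energy_le C (u_ k).
Proof.
move=> cu; rewrite /limn_esup /limf_esup => /ereal_inf_lt[_ [V [k0 _ hV] <-]].
set S := ereal_sup _ => Sfin.
have dS k : (k0 <= k)%N -> (dirichlet (u_ k) <= S)%E.
  by move=> k0k; apply: ereal_sup_ubound; exists k => //; exact: hV.
have d0 u : (0 <= dirichlet u)%E.
  rewrite /dirichlet; case: asboolP => // _; apply: integral_ge0 => s _.
  by rewrite lee_fin sqr_ge0.
have S0 : (0 <= S)%E := le_trans (d0 _) (dS k0 (leqnn k0)).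
exists (fine S); split; first exact: fine_ge0.
exists k0 => k k0k; apply: dirichlet_energy => //.
by rewrite fineK ?ge0_fin_numE// dS.
Qed.

(** The failure of the sign condition at -oo reduces to the failure at +oo by the
    symmetry that replaces w(s) by - w(-s) and W(s) by W(-s). *)
Lemma sign_changes_far (C : R) w W : 0 <= C ->
  (forall a b, a <= b -> (w b - w a) ^+ 2 <= C * (b - a)) ->
  (forall x, is_derive x 1 W (w x)) -> (forall s, W 0 <= W s) ->
  ~ ((forall d, 0 < d -> exists A, forall s, A < s -> - d <= w s) /\
     (forall d, 0 < d -> exists A, forall s, s < A -> w s <= d)) ->
  forall n : R, exists a b, [/\ a <= b, forall s, a <= s -> s <= b -> n <= `|s| &
    w a * w b < 0].
Proof.
move=> C0 wC dW Wmin /not_andP[bad|bad] n.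
  have [a [b [na nb wa wb]]] := sign_changes_pinfty C0 wC dW Wmin bad n.
  have wab : w a * w b < 0 by rewrite pmulr_llt0.
  have [ab|/ltW ba] := leP a b; [exists a, b|exists b, a]; split => //.
  - by move=> s as_ _; apply: le_trans (ler_norm s); exact: le_trans as_.
  - by move=> s bs _; apply: le_trans (ler_norm s); exact: le_trans bs.
  - by rewrite mulrC.
pose w' s := - w (- s); pose W' s := W (- s).
have wC' a b : a <= b -> (w' b - w' a) ^+ 2 <= C * (b - a).
  move=> ab; have := wC (- b) (- a); rewrite lerN2 => /(_ ab).
  by rewrite /w'; congr (_ <= _); [congr (_ ^+ 2)|congr (_ * _)]; ring.
have dW' x : is_derive x 1 W' (w' x).
  have := @is_derive_affine _ W (- 1) 0 x _ (dW _).
  by rewrite /W' /w'; under eq_fun do rewrite mulN1r addr0; rewrite !mulN1r addr0.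
have Wmin' s : W' 0 <= W' s by rewrite /W' oppr0.
have bad' : ~ (forall d, 0 < d -> exists A, forall s, A < s -> - d <= w' s).
  move=> h; apply: bad => d /h[A hA]; exists (- A) => s sA.
  by have := hA (- s); rewrite ltrNr => /(_ sA); rewrite /w' opprK lerN2.
have [a [b [na nb wa wb]]] := sign_changes_pinfty C0 wC' dW' Wmin' bad' n.
have wab : w (- a) * w (- b) < 0.
  by rewrite -mulrNN pmulr_llt0.
have far s x : n <= x -> s <= - x -> n <= `|s|.
  by move=> nx sx; rewrite -normrN; apply: le_trans (ler_norm _); lra.
have [ab|/ltW ba] := leP a b; [exists (- b), (- a)|exists (- a), (- b)]; split.
- by rewrite lerN2.
- by move=> s _; exact: far.
- by rewrite mulrC.
- by rewrite lerN2.
- by move=> s _; exact: far.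
- by [].
Qed.

End Assembly.

(** * The limit of the recentred sequence *)

Theorem lemma1 (R : realType) (u_ : nat -> R -> R)
    (u_cont : forall k, continuous (u_ k))
    (energy_bound : (limn_esup (fun k => dirichlet (u_ k)) < +oo)%E)
    (limsup_neg : forall k, (limsup_ninfty (u_ k) < 0)%E)
    (liminf_pos : forall k, (0 < liminf_pinfty (u_ k))%E) :
  exists z : nat -> R,
    (forall k, u_ k (z k) = 0) /\
    exists u : R -> R,
      [/\ H1dot u,
          u 0 = 0,
          exists sigma : nat -> nat,
            [/\ increasing_seq sigma,
                locally_uniform_cvg
                  (fun j s => u_ (sigma j) (s + z (sigma j))) u &
                weak_cvg_H1dot
                  (fun j s => u_ (sigma j) (s + z (sigma j))) u],
          (limsup_ninfty u <= 0)%E &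
          (0 <= liminf_pinfty u)%E].
Proof.
have [C [C0 [k0 uC]]] := energy_le_eventually u_cont energy_bound.
have /choice[z hz] : forall k, exists z, u_ k z = 0 /\ exists2 U : R -> R,
    (forall x : R, is_derive x 1 U (u_ k x)) & forall s, U z <= U s.
  move=> k; apply: zero_at_minimum => //.
    exact: limsup_ninfty_lt0.
  exact: liminf_pinfty_gt0.
have /choice[U hU] : forall k, exists U : R -> R,
    (forall x : R, is_derive x 1 U (u_ k x)) /\ forall s, U (z k) <= U s.
  by move=> k; have [_ [U dU Umin]] := hz k; exists U.
have uz k : u_ k (z k) = 0 by case: (hz k).
(* Only from k0 on is the energy finite, so indices are offset by k0. *)
pose v j s := u_ (j + k0)%N (s + z (j + k0)%N).
have vC j : energy_le C (v j) by apply/energy_shift/uC; exact: leq_addl.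
have v0 j : v j 0 = 0 by rewrite /v add0r uz.
have [w [sigma sinc vw]] := hoelder_compactness C0 v0
  (fun k a b ab => energy_hoelder C0 (vC k) ab).
have vsC j : energy_le C (v (sigma j)) by exact: vC.
have wC := energy_limit vsC vw; have [cw _] := wC.
have w0 : w 0 = 0.
  apply/eqP; rewrite -normr_le0; apply/ler_addgt0Pr => e e0; rewrite add0r.
  have [N hN] := vw 0 e e0.
  by have := hN N 0 (leqnn N); rewrite v0 sub0r normrN normr0; apply.
have [W dW] := antiderivative cw.
have Wmin : forall s, W 0 <= W s.
  pose V j s := U (sigma j + k0)%N (s + z (sigma j + k0)%N).
  apply: (@minimum_limit _ (fun j => v (sigma j)) V w W) => //.
    move=> j x; have [dU _] := hU (sigma j + k0)%N.
    exact: is_derive_translate.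
  by move=> j s; rewrite /V add0r; case: (hU (sigma j + k0)%N).
have wH a b : a <= b -> (w b - w a) ^+ 2 <= C * (b - a).
  by move=> ab; exact: energy_hoelder.
have sinc0 : increasing_seq (fun j => (sigma j + k0)%N).
  by move=> m n; rewrite /= !leEnat leq_add2r; exact: sinc.
have [good|bad] := pselect
  ((forall d, 0 < d -> exists A, forall s, A < s -> - d <= w s) /\
   (forall d, 0 < d -> exists A, forall s, s < A -> w s <= d)).
  case: good => goodr goodl.
  exists z; split=> //; exists w; split=> //.
  - by have [] := energy_H1dot C0 wC.
  - exists (fun j => (sigma j + k0)%N); split => //.
      exact: cvg_loc_locally_uniform.
    exact: energy_weak_cvg C0 vsC vw.
  - exact: limsup_ninfty_le0.
  - exact: liminf_pinfty_ge0.
(* Otherwise the zeros are moved, along the subsequence rho only, to zeros near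
   far sign changes of w, and the recentred limit is 0. *)
have changes n : exists a b : R, [/\ a <= b,
    forall s, a <= s -> s <= b -> n <= `|s| & w a * w b < 0].
  exact: (sign_changes_far C0 wH dW Wmin bad).
have [tau [y [tinc vy vt]]] := vanishing_limit C0 vsC vw changes.
pose rho j := (sigma (tau j) + k0)%N.
have rinc : increasing_seq rho by move=> m n; rewrite sinc0; exact: tinc.
have rinj : injective rho by exact: (inc_inj rinc).
have /choice[z' hz'] : forall k, exists x, u_ k x = 0 /\
    forall j, k = rho j -> x = y j + z k.
  move=> k; have [[j kj]|none] := pselect (exists j, k = rho j).
    exists (y j + z k); split; first by rewrite kj; exact: vy.
    by move=> i; rewrite kj => /rinj ->.
  by exists (z k); split => // j kj; case: none; exists j.
have z'E : (fun j s => u_ (rho j) (s + z' (rho j))) =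
    (fun j s => v (sigma (tau j)) (s + y j)).
  apply/funext => j; apply/funext => s.
  by rewrite ((hz' (rho j)).2 j erefl) addrA.
have vyC j : energy_le C (fun s => v (sigma (tau j)) (s + y j)).
  exact: energy_shift.
exists z'; split; first by move=> k; case: (hz' k).
exists (cst 0); split => //.
- by have [] := energy_H1dot C0 (energy_limit vyC vt).
- exists rho; rewrite z'E; split => //; first exact: cvg_loc_locally_uniform.
  exact: energy_weak_cvg C0 vyC vt.
- by apply: limsup_ninfty_le0 => d d0; exists 0 => s _; exact: ltW.
- by apply: liminf_pinfty_ge0 => d d0; exists 0 => s _; rewrite oppr_le0 ltW.
Qed.
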